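(* Let $d$ be a (pseudo)metric on $\mathcal R(\Omega,\mathcal X)$ and $(\mathbf X^s,\mathbf U^s)$ a stationary pair with $|\ell(\mathbf X^s,\mathbf U^s)|<\infty$. Assume: (1) the optimal control problem is strictly stochastically dissipative at $(\mathbf X^s,\mathbf U^s)$ with respect to $d$, with storage function $\lambda$ and $\alpha\in\mathcal K_\infty$; (2) there is $r>0$ such that $\lambda$ is uniformly bounded on $\bar B^d_r(\mathbf X^s)$ and $\mathbf X^s$ is cheaply reachable on $\bar B^d_r(\mathbf X^s)$ with constant $C_V$; (3) there exist $\varepsilon>0$ and $\gamma_V:\mathbb R_{\ge0}\times\mathbb R_{\ge0}\to\mathbb R_{\ge0}$ with $\gamma_V(N,\rho)\to0$ as $N\to\infty$ and $\rho\to0$, and with $\gamma_V(\cdot,\rho)$, $\gamma_V(N,\cdot)$ monotone for fixed $\rho$ and $N$, such that $|V_N(j,X_j)-V_N(j,X^s(j))|\le\gamma_V(N,d(X_j,X^s(j)))$ for all $N\in\mathbb N$, $j\in\mathbb N_0$, $X_j\in\bar B^d_\varepsilon(X^s(j))$; (4) $\tilde\ell(j,X^s(j),U^s(j))=0$ for all $j\in\mathbb N_0$; (5) there exist $\tilde r\ge\tilde\varepsilon>0$ and $\gamma_\lambda,\gamma_{\tilde V}\in\mathcal K_\infty$ such that for all $N\in\mathbb N$, $j\in\mathbb N_0$: $|\lambda(j,X_j)-\lambda(j,X^s(j))|\le\gamma_\lambda(d(X_j,X^s(j)))$ for all $X_j\in\bar B^d_{\tilde\varepsilon}(X^s(j))$,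 and $|\tilde V_N(j,X_j)-\tilde V_N(j,X^s(j))|\le\gamma_{\tilde V}(d(X_j,X^s(j)))$ for all $X_j\in\bar B^d_{\tilde r}(X^s(j))$; (6) there exist $\hat\varepsilon>0$ and $\gamma_{V_\infty}\in\mathcal K$ such that $|\hat V_\infty(j,X_j)-\hat V_\infty(j,X^s(j))|\le\gamma_{V_\infty}(d(X_j,X^s(j)))$ for all $j\in\mathbb N_0$, $X_j\in\bar B^d_{\hat\varepsilon}(X^s(j))$. With $\vartheta(L):=\alpha^{-1}\big((C_\lambda+C_\lambda^l+C_V)/L\big)$, where $C_\lambda$ is a uniform bound of $|\lambda|$ on $\bar B^d_r(\mathbf X^s)$ and $-C^l_\lambda$ a uniform lower bound of $\lambda$ ($C_\lambda,C_\lambda^l>0$), set $$\nu(N):=8\gamma_{\tilde V}\big(\vartheta(\tfrac N{12})\big)+4\gamma_\lambda\big(\vartheta(\tfrac N{12})\big)+4\gamma_V\big(\tfrac N2,\vartheta(\tfrac N{12})\big).$$ Then there exist $\theta_0>0$, $N_0\in\mathbb N$, $\delta\in\mathcal L$ and $\beta\in\mathcal{KL}$ such that, with $\mathcal Y_N(j):=\tilde V_N^{-1}(j,[0,\theta_0])$ and $\mathcal P_N(j):=\tilde V_N^{-1}(j,[0,\delta(N)])$, (a) for all $N\ge N_0$ the families $\mathcal Y_N(\cdot)$, $\mathcal P_N(\cdot)$ are forward invariant and $\tilde V_N$ is a uniform time-varying Lyapunov function for the MPC closed loop on $\mathcal Y_N(j)\setminus\mathcal P_N(j)$, and for all $N\ge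 N_0$, $j_0,j\in\mathbb N_0$ and $X_{j_0}\in\mathcal Y_N(j_0)$ with $X_{\mu_N}(j;j_0,X_{j_0})\notin\mathcal P_N(j_0+j)$ one has $d(X_{\mu_N}(j;j_0,X_{j_0}),X^s(j+j_0))\le\beta(d(X_{j_0},X^s(j_0)),j)$; (b) there exist $\delta_2,\delta_3\in\mathcal L$ such that for all sufficiently large $N,K\in\mathbb N$ and all $X_0\in\tilde V_N^{-1}(0,[0,\theta_0])$, $$J_K^{cl}(X_0,\mu_N)\le\inf_{\mathbf U\in\mathbb U_{ad}^{K,\kappa}(X_0)}J_K(0,X_0,\mathbf U)+\delta_2(N)+K\nu(N)+\delta_3(K),$$ where $\kappa=\max\{\beta(d(X_0,X^s(0)),K),\alpha^{-1}(\delta(N))\}$ and $\mathbb U_{ad}^{K,\kappa}(X_0):=\{\mathbf U\in\mathbb U_{ad}^K(0,X_0): X_{\mathbf U}(K;0,X_0)\in\bar B^d_\kappa(X^s(K))\}$.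
   Context: Setting. $\mathcal X,\mathcal U,\mathcal W$ are separable Banach spaces, $f:\mathcal X\times\mathcal U\times\mathcal W\to\mathcal X$ is continuous, $(\Omega,\mathcal F,\mathbb P)$ is a probability space, and for $\mathcal Z\in\{\mathcal X,\mathcal U,\mathcal W\}$, $\mathcal R(\Omega,\mathcal Z)$ is the set of measurable maps $(\Omega,\mathcal F)\to(\mathcal Z,\mathcal B(\mathcal Z))$. $W(0),W(1),\dots\in\mathcal R(\Omega,\mathcal W)$ are i.i.d. with distribution $P_W$; throughout, the noise acting at any time is independent of the state and the control at that time. $\mathbb U\subseteq\mathcal U$ is a control constraint set. $g:\mathcal X\times\mathcal U\to\mathbb R$ is lower semicontinuous and bounded from below, and $\ell(X,U):=\mathbb E[g(X,U)]$. Optimal control problem. For $j\in\mathbb N_0$, $X_j\in\mathcal R(\Omega,\mathcal X)$ and a control sequence $\mathbf U=(U(0),U(1),\dots)$, $X_{\mathbf U}(0;j,X_j)=X_j$, $X_{\mathbf U}(k+1;j,X_j)=f(X_{\mathbf U}(k;j,X_j),U(k),W(j+k))$. $\mathbb U_{ad}(X):=\{U\in\mathcal R(\Omega,\mathcal U):\sigma(U)\subseteq\sigma(X),\ U(\omega)\in\mathbb U\ \forall\omega\}$; $\mathbb U^N_{ad}(j,X_j)$ ($N\in\mathbb N\cup\{\infty\}$) is the set of control sequences with $U(k)\in\mathbb U_{ad}(X_{\mathbf U}(k;j,X_j))$ for all $0\le k\le N-1$. $J_N(j,X_j,\mathbf U):=\sum_{k=0}^{N-1}\ell(X_{\mathbf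 U}(k;j,X_j),U(k))$, $V_N(j,X_j):=\inf_{\mathbf U\in\mathbb U^N_{ad}(j,X_j)}J_N(j,X_j,\mathbf U)$, $V_0\equiv0$. Minimizers are denoted $\mathbf U^*_{N}=\mathbf U^*_{N,j,X_j}$; minimizers are assumed to exist whenever they are referred to. MPC feedback: $\mu_N(X_j):=U^*_{N,j,X_j}(0)$, the first element of an optimal control sequence at time $j$ and state $X_j$ (any choice of minimizer). $X_{\mu_N}(\cdot;j_0,X_{j_0})$ is the closed-loop trajectory started at time $j_0$ in $X_{j_0}$ (first argument: elapsed steps): $X_{\mu_N}(0;j_0,X_{j_0})=X_{j_0}$, $X_{\mu_N}(j+1;j_0,X_{j_0})=f(X,\mu_N(X),W(j_0+j))$ with $X=X_{\mu_N}(j;j_0,X_{j_0})$. $J_K^{cl}(X_0,\mu_N):=\sum_{j=0}^{K-1}\ell(X_{\mu_N}(j;0,X_0),\mu_N(X_{\mu_N}(j;0,X_0)))$. A family $\mathcal Y(j)\subseteq\mathcal R(\Omega,\mathcal X)$ is forward invariant if $f(X_j,\mu_N(X_j),W(j))\in\mathcal Y(j+1)$ for all $X_j\in\mathcal Y(j)$, $j\in\mathbb N_0$. Stationary pair: processes $(\mathbf X^s,\mathbf U^s)$ with $X^s(k+1)=f(X^s(k),U^s(k),W(k))$, $\mathbf U^s\in\mathbb U^\infty_{ad}(0,X^s(0))$, such that the laws of $X^s(k)$, $U^s(k)$ and $(X^s(k),U^s(k))$ do not depend on $k\in\mathbb N_0$; $\ell(\mathbf X^s,\mathbf U^s)$ denotes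 the constant value $\ell(X^s(k),U^s(k))$. (Pseudo)metrics $d:\mathcal R(\Omega,\mathcal X)^2\to[0,\infty]$ may take the value $\infty$. $\bar B^d_r(X^s(j)):=\{X\in\mathcal R(\Omega,\mathcal X):d(X,X^s(j))\le r\}$, $\bar B^d_r(\mathbf X^s):=\{(j,X_j):j\in\mathbb N_0,\ X_j\in\bar B^d_r(X^s(j))\}$. Comparison functions on $[0,\infty)$: $\mathcal K$: continuous, strictly increasing, zero at $0$; $\mathcal K_\infty$: unbounded functions in $\mathcal K$; $\mathcal L$: continuous, strictly decreasing to $0$; $\mathcal{KL}$: continuous $\beta:[0,\infty)^2\to[0,\infty)$ with $\beta(\cdot,t)\in\mathcal K$ for all $t$ and $\beta(s,\cdot)\in\mathcal L$ for all $s$. Strict stochastic dissipativity at $(\mathbf X^s,\mathbf U^s)$ w.r.t. $d$: there are a storage function $\lambda:\mathbb N_0\times\mathcal R(\Omega,\mathcal X)\to\mathbb R$, uniformly bounded from below, and $\alpha\in\mathcal K_\infty$ with $$\tilde\ell(j,X,U):=\ell(X,U)-\ell(\mathbf X^s,\mathbf U^s)+\lambda(j,X)-\lambda(j+1,f(X,U,W(j)))\ge\alpha(d(X,X^s(j)))$$ for all $j\in\mathbb N_0$, $X\in\mathcal R(\Omega,\mathcal X)$, $U\in\mathbb U_{ad}(X)$. Cheap reachability on $\bar B^d_r(\mathbf X^s)$ with constant $C_V>0$: $V_N(j,X_j)-N\ell(\mathbf X^s,\mathbf U^s)\le C_V$ for all $(j,X_j)\in\bar B^d_r(\mathbf X^s)$,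 $N\in\mathbb N$. Modified problem: $\tilde J_N(j,X_j,\mathbf U):=\sum_{k=0}^{N-1}\tilde\ell(j+k,X_{\mathbf U}(k;j,X_j),U(k))$, $\tilde V_N(j,X_j):=\inf_{\mathbf U\in\mathbb U^N_{ad}(j,X_j)}\tilde J_N(j,X_j,\mathbf U)$, $\tilde V_N^{-1}(j,[0,a]):=\{X\in\mathcal R(\Omega,\mathcal X):\tilde V_N(j,X)\in[0,a]\}$. Shifted problem: $\hat\ell(X,U):=\ell(X,U)-\ell(\mathbf X^s,\mathbf U^s)$, $\hat J_N(j,X_j,\mathbf U):=\sum_{k=0}^{N-1}\hat\ell(X_{\mathbf U}(k;j,X_j),U(k))$ and $\hat V_N(j,X_j):=\inf_{\mathbf U\in\mathbb U^N_{ad}(j,X_j)}\hat J_N(j,X_j,\mathbf U)$ for $N\in\mathbb N\cup\{\infty\}$ (infinite sums are limits of partial sums). Uniform time-varying Lyapunov function on $\mathcal S(j)\subseteq\mathcal R(\Omega,\mathcal X)$, $j\in\mathbb N_0$: a function $V:\{(j,X_j):j\in\mathbb N_0,X_j\in\mathcal S(j)\}\to[0,\infty)$ for which there are $\alpha_1,\alpha_2\in\mathcal K_\infty$, $\alpha_V\in\mathcal K$ such that (i) $\alpha_1(d(X_j,X^s(j)))\le V(j,X_j)\le\alpha_2(d(X_j,X^s(j)))$ and (ii) $V(j+1,f(X_j,\mu_N(X_j),W(j)))\le V(j,X_j)-\alpha_V(d(X_j,X^s(j)))$ hold for all $j\in\mathbb N_0$ and all $X_j\in\mathcal S(j)$ with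 $f(X_j,\mu_N(X_j),W(j))\in\mathcal S(j+1)$.
   Formalization: For β∈KL, β(s,·)∈L is required only for s>0, since β(0,t)=0 for all t rules out strict decrease at s=0; ''monotone'' for γ_V(N,·) is read as nondecreasing in ρ. *)

(* Defs.v *)
From HB Require Import structures.
From mathcomp Require Import all_boot all_order all_algebra.
From mathcomp Require Import all_classical all_reals all_analysis.

Set Implicit Arguments.
Unset Strict Implicit.
Unset Printing Implicit Defensive.
Import Order.TTheory GRing.Theory Num.Theory.
Import numFieldNormedType.Exports.
Local Open Scope classical_set_scope.
Local Open Scope ring_scope.

(* Comparison functions: total functions on R of which only the restriction to
   [0, +oo[ matters. They are applied to extended distances through er_map,
   i.e. with value +oo at +oo. *)
Section comparison_functions.
Context {R : realType}.
Implicit Types (a : R -> R) (b : R -> R -> R).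

Definition nonneg : set R := [set s | 0 <= s].

Definition class_K a :=
  [/\ {within nonneg, continuous a},
      (forall s t, 0 <= s -> s < t -> a s < a t) & a 0 = 0].

Definition class_Kinf a :=
  class_K a /\ forall M, exists2 s, 0 <= s & M < a s.

Definition class_L a :=
  [/\ {within nonneg, continuous a},
      (forall s t, 0 <= s -> s < t -> a t < a s) & a t @[t --> +oo] --> (0 : R)].

(* b s is required to be in class L for s > 0 only: b 0 vanishes identically
   because every b ^~ t is in class K. *)
Definition class_KL b :=
  [/\ {within [set p : R * R | 0 <= p.1 /\ 0 <= p.2],
         continuous (fun p => b p.1 p.2)},
      (forall t, 0 <= t -> class_K (b ^~ t)) &
      (forall s, 0 < s -> class_L (b s))].

Definition class_Kinv a : R -> R := 'pinv_(fun=> 0) nonneg a.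

End comparison_functions.

Definition separable (T : topologicalType) :=
  exists2 A : set T, countable A & dense A.

Section random_elements.
Context {R : realType} {d : measure_display} {Omega : measurableType d}.
Variable P : probability Omega R.

Definition borel (Z : topologicalType) : set (set Z) := <<s @open Z >>.

Definition random_element (Z : topologicalType) : set (Omega -> Z) :=
  [set Y | forall B, borel B -> measurable (Y @^-1` B)].

Definition sigma_gen (Z : topologicalType) (Y : Omega -> Z) : set (set Omega) :=
  preimage_set_system setT Y (@borel Z).

Definition same_law (Z : topologicalType) (Y Y' : Omega -> Z) :=
  forall B, borel B -> P (Y @^-1` B) = P (Y' @^-1` B).

Definition independent2 (Z Z' : topologicalType)
    (Y : Omega -> Z) (Y' : Omega -> Z') :=
  forall B B', borel B -> borel B' ->
    P (Y @^-1` B `&` Y' @^-1` B') = (P (Y @^-1` B) * P (Y' @^-1` B'))%E.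

Definition mutually_independent (Z : topologicalType) (Y : nat -> Omega -> Z) :=
  forall (I : seq nat) (B : nat -> set Z), uniq I -> (forall k, borel (B k)) ->
    P (\bigcap_(k in [set` I]) (Y k @^-1` B k)) =
    (\prod_(k <- I) fine (P (Y k @^-1` B k)))%:E.

End random_elements.

Record stochastic_ocp (R : realType) (X U W : completeNormedModType R)
    (d : measure_display) (Omega : measurableType d) (P : probability Omega R) :=
  StochasticOCP {
    dyn : X * U * W -> X;
    noise : nat -> Omega -> W;
    noise_law : probability (g_sigma_algebraType (@open W)) R;
    ctrl_set : set U;
    cost_fun : X * U -> R;
    dyn_continuous : continuous dyn;
    noise_random : forall k, random_element (noise k);
    noise_distribution : forall k B, borel B -> P (noise k @^-1` B) = noise_law B;
    noise_independent : mutually_independent P noise;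
    cost_fun_lsc : lower_semicontinuous (fun p => (cost_fun p)%:E);
    cost_fun_bounded : exists m, forall p, m <= cost_fun p }.

Section stochastic_control.
Context {R : realType} {X U W : completeNormedModType R} {dO : measure_display}
  {Omega : measurableType dO} {P : probability Omega R}.
Variable sys : stochastic_ocp X U W P.
Local Open Scope ereal_scope.

Let RX := Omega -> X.
Let RU := Omega -> U.

Definition ell (Y : RX) (v : RU) : \bar R :=
  'E_P[fun w => cost_fun sys (Y w, v w)].

Definition step (j : nat) (Y : RX) (v : RU) : RX :=
  fun w => dyn sys (Y w, v w, noise sys j w).

(* traj j Y Vs k is the state after k steps, started at time j in Y. *)
Fixpoint traj (j : nat) (Y : RX) (Vs : nat -> RU) (k : nat) : RX :=
  if k is k'.+1 then step (j + k') (traj j Y Vs k') (Vs k') else Y.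

Definition Uad (Y : RX) : set RU :=
  [set v | [/\ random_element v, sigma_gen v `<=` sigma_gen Y &
               forall w, ctrl_set sys (v w)]].

Definition Uad_fin (N j : nat) (Y : RX) : set (nat -> RU) :=
  [set Vs | forall k, (k < N)%N -> Uad (traj j Y Vs k) (Vs k)].

Definition Uad_inf (j : nat) (Y : RX) : set (nat -> RU) :=
  [set Vs | forall k, Uad (traj j Y Vs k) (Vs k)].

(* The admissible states at time j: the random elements of X for which the
   noise acting at any time from j on is independent of the state and the
   control at that time, along every admissible control sequence. This set of
   random elements is invariant under the controlled dynamics, and it is what
   "X_j" ranges over below. *)
Definition state (j : nat) : set RX :=
  [set Y | random_element Y /\
     forall Vs, Uad_inf j Y Vs -> forall k,
       independent2 P (fun w => (traj j Y Vs k w, Vs k w)) (noise sys (j + k))].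

Section functionals.
(* time-varying stage cost *)
Variable c : nat -> RX -> RU -> \bar R.

Definition cost (N j : nat) (Y : RX) (Vs : nat -> RU) : \bar R :=
  \sum_(0 <= k < N) c (j + k)%N (traj j Y Vs k) (Vs k).

Definition cost_inf (j : nat) (Y : RX) (Vs : nat -> RU) : \bar R :=
  \sum_(0 <= k <oo) c (j + k)%N (traj j Y Vs k) (Vs k).

Definition value (N j : nat) (Y : RX) : \bar R :=
  ereal_inf [set cost N j Y Vs | Vs in Uad_fin N j Y].

Definition value_inf (j : nat) (Y : RX) : \bar R :=
  ereal_inf [set cost_inf j Y Vs | Vs in Uad_inf j Y].

End functionals.

Definition J := cost (fun=> ell).
Definition V := value (fun=> ell).

(* mu N j Y is the first element of some minimizer for horizon N, initial time
   j and initial state Y; in particular such minimizers exist. *)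
Definition mpc_feedback (mu : nat -> nat -> RX -> RU) :=
  forall N j Y, (0 < N)%N -> state j Y ->
    exists2 Vs, Uad_fin N j Y Vs & J N j Y Vs = V N j Y /\ mu N j Y = Vs 0%N.

Section closed_loop.
(* time-varying feedback law *)
Variable mu : nat -> RX -> RU.

Definition cl_step (j : nat) (Y : RX) : RX := step j Y (mu j Y).

Fixpoint cl_traj (j0 : nat) (Y : RX) (j : nat) : RX :=
  if j is j'.+1 then cl_step (j0 + j') (cl_traj j0 Y j') else Y.

Definition Jcl (K : nat) (Y : RX) : \bar R :=
  \sum_(0 <= j < K) ell (cl_traj 0 Y j) (mu j (cl_traj 0 Y j)).

Definition forward_invariant (A : nat -> set RX) :=
  forall j Y, A j Y -> A j.+1 (cl_step j Y).

End closed_loop.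

(* Only the values on random elements matter. *)
Definition pseudometric (d : RX -> RX -> \bar R) :=
  [/\ forall Y Z, random_element Y -> random_element Z -> 0 <= d Y Z,
      forall Y, random_element Y -> d Y Y = 0,
      forall Y Z, random_element Y -> random_element Z -> d Y Z = d Z Y &
      forall Y Z T, random_element Y -> random_element Z -> random_element T ->
        d Y T <= d Y Z + d Z T].

Section stationary.
Variables (Xs : nat -> RX) (Us : nat -> RU).

Definition stationary_pair :=
  [/\ state 0 (Xs 0%N), Uad_inf 0 (Xs 0%N) Us,
      (forall k, Xs k.+1 = step k (Xs k) (Us k)) &
      (forall k, [/\ same_law P (Xs k) (Xs 0%N), same_law P (Us k) (Us 0%N) &
         same_law P (fun w => (Xs k w, Us k w))
                    (fun w => (Xs 0%N w, Us 0%N w))])].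

(* For a stationary pair ell (Xs k) (Us k) does not depend on k. *)
Definition ell_s : \bar R := ell (Xs 0%N) (Us 0%N).

Definition ell_hat (j : nat) (Y : RX) (v : RU) : \bar R := ell Y v - ell_s.

Definition V_hat_inf := value_inf ell_hat.

Section dissipativity.
Variable lambda : nat -> RX -> R.

Definition ell_tilde (j : nat) (Y : RX) (v : RU) : \bar R :=
  ell Y v - ell_s + (lambda j Y)%:E - (lambda j.+1 (step j Y v))%:E.

Definition V_tilde := value ell_tilde.

Definition V_tilde_preim (N : nat) (a : R) (j : nat) : set RX :=
  [set Y | state j Y /\ 0 <= V_tilde N j Y <= a%:E].

End dissipativity.

Section distance.
Variable d : RX -> RX -> \bar R.

Definition cl_ball (r : \bar R) (j : nat) : set RX :=
  [set Y | state j Y /\ d Y (Xs j) <= r].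

Definition strictly_dissipative (lambda : nat -> RX -> R) (alpha : R -> R) :=
  [/\ exists m : R, forall j Y, state j Y -> (m <= lambda j Y)%R,
      class_Kinf alpha &
      forall j Y v, state j Y -> Uad Y v ->
        er_map alpha (d Y (Xs j)) <= ell_tilde lambda j Y v].

Definition cheaply_reachable (r CV : R) :=
  forall N j Y, (0 < N)%N -> cl_ball r%:E j Y ->
    V N j Y - N%:R%:E * ell_s <= CV%:E.

Definition uniform_lyapunov (mu : nat -> RX -> RU) (A : nat -> set RX)
    (L : nat -> RX -> \bar R) :=
  (forall j Y, A j Y -> 0 <= L j Y < +oo) /\
  exists alpha1 alpha2 alphaV : R -> R,
    [/\ class_Kinf alpha1, class_Kinf alpha2, class_K alphaV &
      forall j Y, A j Y -> A j.+1 (cl_step mu j Y) ->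
        er_map alpha1 (d Y (Xs j)) <= L j Y <= er_map alpha2 (d Y (Xs j)) /\
        L j.+1 (cl_step mu j Y) <= L j Y - er_map alphaV (d Y (Xs j))].

Definition Uad_term (K : nat) (kappa : \bar R) (Y : RX) : set (nat -> RU) :=
  [set Vs | Uad_fin K 0 Y Vs /\ cl_ball kappa K (traj 0 Y Vs K)].

End distance.
End stationary.
End stochastic_control.

Section performance_error.
Context {R : realType}.

Definition vartheta (alpha : R -> R) (C L : R) : R := class_Kinv alpha (C / L).

Definition nu (alpha gtV glam : R -> R) (gV : R -> R -> R) (C : R) (N : nat) : R :=
  let th := vartheta alpha C (N%:R / 12%:R) in
  8%:R * gtV th + 4%:R * glam th + 4%:R * gV (N%:R / 2%:R) th.

End performance_error.

(* Main.v *)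
Require Import Defs.
From mathcomp Require Import all_boot all_order all_algebra.
From mathcomp Require Import all_classical all_reals all_analysis.
From mathcomp Require Import ring lra zify.

Import Order.TTheory GRing.Theory Num.Theory.
Import numFieldNormedType.Exports.
Local Open Scope classical_set_scope.
Local Open Scope ring_scope.

(** Write [x] for the distance of a state to the stationary process and [v] for
    its modified value at horizon [N]. By dissipativity the modified stage cost
    is at least [alpha x], so [alpha x <= v]; the stationary pair has modified
    cost [0], so continuity of the modified value gives [v <= gtV x]. The
    modified value is thus a Lyapunov function as soon as it decreases along
    the closed loop.

    It does so up to the error [nu N], and this is the core of the proof
    ([V_tilde_decrease]). The difficulty is that the controller minimizes the
    cost and not the modified cost. The storage function telescopes, so that
    these two differ, for a given initial state, by the storage at the end of
    the horizon only ([cost_tildeE]). Cheap reachability bounds the modified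
    cost of optimal trajectories uniformly in [N] ([cost_tilde_optimal_le]), so
    these stay close to stationarity most of the time: among [N / 2] consecutive
    times there is one, say [p], at which an optimal trajectory and a near
    minimizer of the modified cost both have distance at most
    [vartheta (N / 12)] ([common_turnpike_time]). Cutting both trajectories at
    [p], where their storages and the values of their tails differ by little,
    shows that the optimal trajectory up to [p] nearly minimizes the modified
    cost as well. Without its first step, and followed by a cheap tail, it is a
    candidate for the next optimization.

    Stability then is a matter of real sequences. If [v'] is the next modified
    value, [v' <= v - alpha x + nu N] leaves two cases: [v] decreases by
    [alpha x / 2], or [nu N] dominates, and then [v] is so small that [v'] is at
    most [residual N] ([decrease_or_residual]). Hence small sublevel sets of
    level at least [residual N] are forward invariant, and summing up the decrease outside of
    them yields a class KL bound ([decay_boundP]). As [residual N] tends to [0],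
    it has a class L majorant [delta] ([class_L_majorant]).

    For the performance estimate ([closed_loop_cost_le]), modified costs are
    compared once more. That of the closed loop up to time [K] is at most the
    modified value plus [K * nu N]. A competitor that ends at distance [k] from
    stationarity can be continued at modified cost at most [gtV k], so its
    modified cost is at least the modified value minus [gtV k]. Both
    trajectories end within the terminal radius, which is bounded by the maximum
    of a class L function of [K] and one of [N]. *)

(** * Comparison functions *)

Section comparison_function_calculus.
Context {R : realType}.
Implicit Types (a b f g : R -> R) (s t x y : R).
Set Implicit Arguments.
Unset Strict Implicit.

Lemma max0_ge0 x : 0 <= Num.max 0 x.
Proof. by rewrite le_max lexx. Qed.

Lemma continuous_max0 : continuous (fun x : R => Num.max 0 x).
Proof. by move=> x; apply: continuous_max; [exact: cvg_cst|exact: cvg_id]. Qed.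

(** Clamping the argument at [0] turns continuity on the half-line into
    continuity on the line, which composes without side conditions. *)
Lemma within_nonneg_continuousP f :
  {within nonneg, continuous f} <-> continuous (fun x => f (Num.max 0 x)).
Proof.
split=> [/subspace_continuousP cf x|cf]; last first.
  apply: (@subspace_eq_continuous _ _ _ (fun x => f (Num.max 0 x))).
    by move=> x; rewrite inE => x0; rewrite max_r.
  exact: continuous_subspaceT.
have := cf _ (max0_ge0 x); apply: (@cvg_comp _ _ _ (Num.max 0) f) => A /= nA.
have nA' : \forall y \near x, nonneg (Num.max 0 y) -> A (Num.max 0 y).
  exact: continuous_max0 nA.
suff : \forall y \near x, A (Num.max 0 y) by [].
by apply: filterS nA' => y; apply; exact: max0_ge0.
Qed.

Lemma class_K_ge0 a x : class_K a -> 0 <= x -> 0 <= a x.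
Proof.
move=> [_ mono a0]; rewrite le_eqVlt => /predU1P[<-|x0]; first by rewrite a0.
by rewrite -a0; apply/ltW/mono.
Qed.

Lemma class_K_le a x y : class_K a -> 0 <= x -> 0 <= y ->
  (a x <= a y) = (x <= y).
Proof.
move=> [_ mono _] x0 y0; case: (leP x y) => [|yx].
  by rewrite le_eqVlt => /predU1P[->|/(mono _ _ x0)/ltW->//]; rewrite lexx.
by apply/negbTE; rewrite -ltNge mono.
Qed.

Lemma class_K_lt a x y : class_K a -> 0 <= x -> 0 <= y ->
  (a x < a y) = (x < y).
Proof. by move=> Ka x0 y0; rewrite !ltNge class_K_le. Qed.

Lemma class_K_continuous a : class_K a -> continuous (fun x => a (Num.max 0 x)).
Proof. by case=> /within_nonneg_continuousP. Qed.

Lemma class_L_continuous f : class_L f -> continuous (fun x => f (Num.max 0 x)).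
Proof. by case=> /within_nonneg_continuousP. Qed.

Lemma class_K_comp a b : class_K a -> class_K b -> class_K (a \o b).
Proof.
move=> Ka Kb; split => [|s t s0 st|/=]; last 2 first.
- by rewrite /= class_K_lt ?class_K_ge0 ?class_K_lt// (le_trans s0) ?ltW.
- by case: Kb => _ _ ->; case: Ka.
apply/within_nonneg_continuousP => x.
have -> : (fun x => (a \o b) (Num.max 0 x)) =
    (fun x => a (Num.max 0 x)) \o (fun x => b (Num.max 0 x)).
  apply/funext => z /=; congr a; rewrite [RHS]max_r// class_K_ge0//.
  by rewrite le_max lexx.
by apply: continuous_comp; exact: class_K_continuous.
Qed.

Lemma class_K_id : class_K (@id R).
Proof. by split=> //; apply: continuous_subspaceT => x; exact: cvg_id. Qed.

Lemma class_KD a b : class_K a -> class_K b -> class_K (a \+ b).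
Proof.
move=> Ka Kb; have [_ ma a0] := Ka; have [_ mb b0] := Kb.
split => [|s t s0 st|/=].
- apply/within_nonneg_continuousP => x.
  by apply: continuousD; exact: class_K_continuous.
- by rewrite /= ltrD ?ma ?mb.
- by rewrite a0 b0 addr0.
Qed.

Lemma class_KZ (k : R) a : 0 < k -> class_K a -> class_K (k \*o a).
Proof.
move=> k0 Ka; have [_ ma a0] := Ka; split => [|s t s0 st|/=].
- apply/within_nonneg_continuousP => x.
  by apply: cvgMr; exact: class_K_continuous.
- by rewrite /= ltr_pM2l ?ma.
- by rewrite a0 mulr0.
Qed.

Lemma class_Kinf_surj a y : class_Kinf a -> 0 <= y ->
  exists2 x, 0 <= x & a x = y.
Proof.
move=> [Ka ub] y0; have [x x0 yx] := ub y.
have [||c /andP[c0 cx] <-] := @IVT _ a 0 x y x0; last by exists c.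
- apply: (@continuous_subspaceW _ _ _ nonneg); last by case: Ka.
  by move=> z /=; rewrite in_itv/= => /andP[].
- have a0 : a 0 = 0 by case: Ka.
  by rewrite min_l ?max_r ?a0 ?class_K_ge0// y0 ltW.
Qed.

Lemma class_KinvP a y : class_Kinf a -> 0 <= y ->
  0 <= class_Kinv a y /\ a (class_Kinv a y) = y.
Proof.
move=> Ka y0.
have sa : set_surj nonneg (nonneg : set R) a.
  by move=> z /= /(class_Kinf_surj Ka)[x x0 <-]; exists x.
split; last by apply: (surjpK (fun=> 0) sa); rewrite inE.
by apply: (surjpinv_image_sub (dflt := fun=> 0) sa); exists y.
Qed.

Lemma class_Kinv_ge0 a y : class_Kinf a -> 0 <= y -> 0 <= class_Kinv a y.
Proof. by move=> Ka /(class_KinvP Ka)[]. Qed.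

Lemma class_KinvK a y : class_Kinf a -> 0 <= y -> a (class_Kinv a y) = y.
Proof. by move=> Ka /(class_KinvP Ka)[]. Qed.

Lemma class_Kinv_le a x y : class_Kinf a -> 0 <= x -> 0 <= y ->
  (x <= class_Kinv a y) = (a x <= y).
Proof.
move=> Ka x0 y0; rewrite -(class_K_le Ka.1) ?class_Kinv_ge0//.
by rewrite class_KinvK.
Qed.

Lemma class_Kinv_lt a x y : class_Kinf a -> 0 <= x -> 0 <= y ->
  (x < class_Kinv a y) = (a x < y).
Proof.
move=> Ka x0 y0; rewrite -(class_K_lt Ka.1) ?class_Kinv_ge0//.
by rewrite class_KinvK.
Qed.

Lemma class_Kinv_ge a x y : class_Kinf a -> 0 <= x -> 0 <= y ->
  (class_Kinv a y <= x) = (y <= a x).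
Proof. by move=> Ka x0 y0; rewrite !leNgt class_Kinv_lt. Qed.

(** A strictly monotone bijection of the half-line has a continuous inverse:
    [x - e < class_Kinv a z < x + e] is a condition on the position of [z] with
    respect to [a (x - e)] and [a (x + e)]. *)
Lemma class_K_inv a : class_Kinf a -> class_K (class_Kinv a).
Proof.
move=> Ka; have h0 y : 0 <= class_Kinv a (Num.max 0 y).
  by apply: class_Kinv_ge0; rewrite // le_max lexx.
have m0 y : 0 <= Num.max 0 y by rewrite le_max lexx.
split => [|s t s0 st|].
- apply/within_nonneg_continuousP => y; apply/cvgrPdist_lt => e e0.
  set x := class_Kinv a (Num.max 0 y).
  have x0 : 0 <= x := h0 y.
  have xe0 : 0 < x + e by rewrite ltr_wpDl.
  have up : \forall z \near y, class_Kinv a (Num.max 0 z) < x + e.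
    have : y < a (x + e).
      apply: (@le_lt_trans _ _ (Num.max 0 y)); first by rewrite le_max lexx orbT.
      rewrite -[ltLHS](class_KinvK Ka (m0 y)) -/x (class_K_lt Ka.1)//.
        by rewrite ltrDl.
      exact: ltW.
    move=> ylt; near=> z.
    rewrite ltNge class_Kinv_le//; last exact: ltW.
    rewrite -ltNge gt_max (_ : 0 < _).
      by near: z; exact: lt_nbhsl.
    have [_ _ a0] := Ka.1.
    by rewrite -[ltLHS]a0 (class_K_lt Ka.1)// ltW.
  have dn : \forall z \near y, x - e < class_Kinv a (Num.max 0 z).
    have [xe|xe] := ltP (x - e) 0.
      by near=> z; apply: lt_le_trans xe (h0 z).
    have : a (x - e) < y.
      have : a (x - e) < Num.max 0 y.
        by rewrite -(class_KinvK Ka (m0 y)) -/x (class_K_lt Ka.1)// gtrBl.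
      by rewrite lt_max ltNge class_K_ge0//; exact: Ka.1.
    move=> ylt; near=> z.
    rewrite class_Kinv_lt// lt_max; apply/orP; right.
    by near: z; exact: lt_nbhsr.
  near=> z; rewrite ltr_distlC; apply/andP; split.
    by near: z.
  by near: z.
- have t0 : 0 <= t by lra.
  by rewrite class_Kinv_lt ?class_KinvK ?class_Kinv_ge0.
- apply/eqP; rewrite eq_le class_Kinv_ge0// andbT class_Kinv_ge//.
  by have [_ _ ->] := Ka.1.
Unshelve. all: by end_near. Qed.

Lemma class_L_gt0 f t : class_L f -> 0 <= t -> 0 < f t.
Proof.
move=> [_ dec /cvgr_gt lim] t0; rewrite ltNge; apply/negP => ft.
have : f (t + 1) < 0 by apply: lt_le_trans ft; apply: dec => //; lra.
move=> /lim [M [_ HM]].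
set u := Num.max (t + 2) (M + 1).
have u1 : t + 1 < u by rewrite lt_max; apply/orP; left; lra.
have u2 : M < u by rewrite lt_max; apply/orP; right; lra.
have := dec (t + 1) u _ u1; have := HM u u2; lra.
Qed.

Lemma class_K_L_comp a f : class_K a -> class_L f -> class_L (a \o f).
Proof.
move=> Ka Lf; split => [|s t s0 st|].
- apply/within_nonneg_continuousP => x.
  have -> : (fun x => (a \o f) (Num.max 0 x)) =
      (fun x => a (Num.max 0 x)) \o (fun x => f (Num.max 0 x)).
    apply/funext => z /=; congr a; rewrite [RHS]max_r//.
    by apply/ltW/(class_L_gt0 Lf); rewrite le_max lexx.
  apply: continuous_comp; first exact: class_L_continuous.
  exact: class_K_continuous.
- have [_ dec _] := Lf.
  have t0 : 0 <= t by lra.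
  by rewrite /= (class_K_lt Ka) ?dec// ltW// (class_L_gt0 Lf).
- have ca : {for 0, continuous (fun x => a (Num.max 0 x))}.
    exact: class_K_continuous.
  have [_ _ limf] := Lf; have [_ _ a0] := Ka.
  have := cvg_comp _ _ limf ca; rewrite /= max_l// a0.
  apply: cvg_trans; apply: near_eq_cvg; near=> t => /=.
  by rewrite max_r// ltW// class_L_gt0.
Unshelve. all: by end_near. Qed.

Lemma class_L_inv1D : class_L (fun t : R => (1 + t)^-1).
Proof.
split => [|x y x0 xy|].
- apply/within_nonneg_continuousP => x.
  apply: cvgV; first by rewrite gt_eqF// ltr_wpDr ?max0_ge0.
  by apply: cvgD; [exact: cvg_cst|exact: continuous_max0].
- by rewrite ltf_pV2 ?posrE; lra.
- apply/cvgrPdist_lt => e e0; near=> t.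
  have t0 : 0 < t by near: t; exact: nbhs_pinfty_gt.
  rewrite sub0r normrN gtr0_norm ?invr_gt0; last lra.
  rewrite invf_plt ?posrE//; last lra.
  have : e^-1 < t by near: t; apply: nbhs_pinfty_gt; rewrite num_real.
  lra.
Unshelve. all: by end_near. Qed.

Lemma class_KL_div h p : class_K h -> class_K p ->
  class_KL (fun s t => h (p s / (1 + t))).
Proof.
move=> Kh Kp; split => [|t t0|s s0].
- apply: (@subspace_eq_continuous _ _ _ (fun q : R * R =>
     h (Num.max 0 (p (Num.max 0 q.1) / (1 + Num.max 0 q.2))))).
    move=> [s t]; rewrite inE /= => -[s0 t0].
    have w0 : 0 <= p s / (1 + t).
      by apply: divr_ge0; [exact: class_K_ge0|exact: addr_ge0].
    by rewrite (max_r s0) (max_r t0) (max_r w0).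
  apply: continuous_subspaceT => q.
  apply: (@continuous_comp _ _ _ (fun q : R * R =>
     p (Num.max 0 q.1) / (1 + Num.max 0 q.2)) (fun x => h (Num.max 0 x)));
    last exact: class_K_continuous.
  apply: cvgM.
    apply: (@continuous_comp _ _ _ fst (fun x => p (Num.max 0 x))).
      exact: cvg_fst.
    exact: class_K_continuous.
  apply: cvgV; first by rewrite gt_eqF// ltr_wpDr ?max0_ge0.
  apply: cvgD; first exact: cvg_cst.
  apply: (@continuous_comp _ _ _ snd (fun x => Num.max 0 x)).
    exact: cvg_snd.
  exact: continuous_max0.
- have k0 : 0 < (1 + t)^-1 by rewrite invr_gt0; lra.
  have := class_K_comp Kh (class_KZ k0 Kp).
  by congr class_K; apply/funext => s /=; rewrite mulrC.
- have ps : 0 < p s by have [_ mp p0] := Kp; rewrite -p0 mp.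
  apply: (@class_K_L_comp h (fun t => p s / (1 + t))) => //.
  exact: (class_K_L_comp (class_KZ ps class_K_id) class_L_inv1D).
Qed.

(** Let the ramp of [n] be [1] up to [n] and [0] from [n + 1] on. The supremum
    of the ramps scaled by the [`|e n|] is Lipschitz because [e] is bounded, and
    tends to [0] because at [t] only the ramps with [n > t - 1] contribute. The
    summand [1 / (1 + t)] makes it strictly decreasing. *)
Lemma class_L_majorant (e : nat -> R) : e n @[n --> \oo] --> 0 ->
  exists2 f, class_L f & forall n, e n <= f n%:R.
Proof.
move=> e_cvg0.
pose ramp n t : R := Num.max 0 (Num.min 1 (n%:R + 1 - t)).
have rampE n t : ramp n t =
    if n%:R + 1 - t <= 0 then 0 else if 1 <= n%:R + 1 - t then 1
    else n%:R + 1 - t.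
  rewrite /ramp; case: (leP 1 (n%:R + 1 - t)) => ?; rewrite maxEle;
    by do 3?case: ifPn; rewrite -?ltNge => *; lra.
have ramp01 n t : 0 <= ramp n t <= 1.
  by rewrite rampE; do 2?case: ifPn; rewrite -?ltNge => *; lra.
have ramp_decr n s t : s <= t -> ramp n t <= ramp n s.
  by rewrite !rampE; do 4?case: ifPn; rewrite -?ltNge => *; lra.
have ramp_lip n s t : s <= t -> ramp n s <= ramp n t + (t - s).
  by rewrite !rampE; do 4?case: ifPn; rewrite -?ltNge => *; lra.
have [M M0 eM] : exists2 M, 0 <= M & forall n, `|e n| <= M.
  have /cvgrPdist_lt/(_ 1 ltr01)[N _ HN] := e_cvg0.
  exists (1 + \sum_(i < N) `|e i|); first by rewrite addr_ge0// sumr_ge0.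
  move=> n; case: (ltnP n N) => nN.
    rewrite (bigD1 (Ordinal nN))//= addrCA lerDl addr_ge0// sumr_ge0//.
  have := HN n nN; rewrite sub0r normrN => /ltW/le_trans; apply.
  by rewrite lerDl sumr_ge0.
pose S t := sup (range (fun n => `|e n| * ramp n t)).
have S_ge n t : `|e n| * ramp n t <= S t.
  apply: ub_le_sup; last by exists n.
  exists M => _ [m _ <-]; rewrite -[M]mulr1; have /andP[? ?] := ramp01 m t.
  exact: ler_pM.
have S_le B t : (forall n, `|e n| * ramp n t <= B) -> S t <= B.
  move=> HB; apply: ge_sup; first by exists (`|e 0| * ramp 0%N t), 0%N.
  by move=> _ [m _ <-].
have S_decr s t : s <= t -> S t <= S s.
  by move=> st; apply: S_le => n; apply: le_trans (S_ge n s);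
  by apply: ler_wpM2l => //; exact: ramp_decr.
have S_lip s t : s <= t -> S s <= S t + M * (t - s).
  move=> st; apply: S_le => n.
  apply: (@le_trans _ _ (`|e n| * (ramp n t + (t - s)))).
    by rewrite ler_wpM2l// ramp_lip.
  by rewrite mulrDr lerD// ler_wpM2r// subr_ge0.
have S_cont : continuous S.
  move=> t; apply/cvgrPdist_lt => eps eps0; near=> s.
  have st : `|t - s| < eps / (M + 1).
    by near: s; apply: cvgr_dist_lt => //; rewrite divr_gt0// ltr_wpDl.
  have : M * `|t - s| < eps.
    move: st; rewrite ltr_pdivlMr ?ltr_wpDl// => st.
    apply: le_lt_trans st; rewrite mulrC ler_wpM2l// lerDl//.
  case: (leP t s) => ts Meps.
    rewrite ger0_norm ?subr_ge0 ?S_decr//; apply: le_lt_trans Meps.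
    by rewrite distrC ger0_norm ?subr_ge0// lerBlDl S_lip.
  rewrite distrC ger0_norm ?subr_ge0 ?S_decr ?(ltW ts)//.
  apply: le_lt_trans Meps; rewrite ger0_norm ?subr_ge0 ?(ltW ts)// lerBlDl.
  by rewrite S_lip ?ltW.
have [invc invd inv0] := class_L_inv1D.
exists (fun t => S t + (1 + t)^-1); last first.
  move=> n; apply: (le_trans (ler_norm _)).
  have r1 : ramp n n%:R = 1 by rewrite /ramp addrAC subrr add0r minxx max_r.
  have := S_ge n n%:R; rewrite r1 mulr1 => /le_trans; apply.
  by rewrite lerDl invr_ge0 addr_ge0.
split.
- apply/within_nonneg_continuousP => t; apply: cvgD.
    apply: (@continuous_comp _ _ _ (fun x => Num.max 0 x) S); last exact: S_cont.
    exact: continuous_max0.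
  exact: (class_L_continuous class_L_inv1D).
- by move=> s t s0 st; rewrite ler_ltD ?S_decr ?invd// ltW.
- rewrite -[X in _ --> X](addr0 0); apply: cvgD => //.
  apply/cvgrPdist_le => eps eps0.
  have /cvgrPdist_lt/(_ eps eps0)[N _ HN] := e_cvg0.
  near=> t; rewrite sub0r normrN ger0_norm; last first.
    apply: le_trans (S_ge 0%N t); have /andP[? _] := ramp01 0%N t.
    exact: mulr_ge0.
  apply: S_le => n; have /andP[? ?] := ramp01 n t; case: (ltnP n N) => nN.
    have Nt : N%:R <= t by near: t; apply: nbhs_pinfty_ge; rewrite num_real.
    have nN' : n%:R + 1 <= N%:R :> R by rewrite natr1 ler_nat.
    rewrite rampE ifT; last lra.
    by rewrite mulr0 ltW.
  have := HN n nN; rewrite sub0r normrN => /ltW ?.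
  by rewrite -[eps]mulr1 ler_pM.
Unshelve. all: by end_near. Qed.

Lemma class_K_cvg0 (a : R -> R) (u : nat -> R) : class_K a ->
  (forall n, 0 <= u n) -> u n @[n --> \oo] --> 0 ->
  a (u n) @[n --> \oo] --> 0.
Proof.
move=> Ka u0 ucvg; have ca : {for 0, continuous (fun x : R => a (Num.max 0 x))}.
  exact: class_K_continuous.
have [_ _ a0] := Ka.
have := cvg_comp _ _ ucvg ca; rewrite /= max_l// a0.
by apply: cvg_trans; apply: near_eq_cvg; near=> n => /=; rewrite max_r.
Unshelve. all: by end_near. Qed.

(** The solution [y] of [a (b^-1 (a y)) = (a s + 2 * b s) / (1 + t)]. *)
Definition decay_bound (a b : R -> R) (s t : R) : R :=
  class_Kinv a (b (class_Kinv a ((a s + 2%:R * b s) / (1 + t)))).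

Lemma class_KL_decay_bound a b : class_Kinf a -> class_Kinf b ->
  class_KL (decay_bound a b).
Proof.
move=> Ka Kb; have Ka' := class_K_inv Ka.
have Kw : class_K (a \+ 2%:R \*o b).
  by apply: class_KD; [exact: Ka.1|exact: class_KZ Kb.1].
exact: (class_KL_div (class_K_comp Ka' (class_K_comp Kb.1 Ka')) Kw).
Qed.

(** As [v] is nonincreasing, [w := a (b^-1 (v n))] is a lower bound of the
    [a (x i)] for [i <= n]. Hence [w <= a (x 0)], and summing up the decrease,
    [n * w / 2 <= v 0 <= b (x 0)]; so [(1 + n) * w <= a (x 0) + 2 * b (x 0)]. *)
Lemma decay_boundP a b (v x : nat -> R) n : class_Kinf a -> class_Kinf b ->
  (forall i, (i <= n)%N -> [/\ 0 <= x i, a (x i) <= v i & v i <= b (x i)]) ->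
  (forall i, (i < n)%N -> v i.+1 <= v i - a (x i) / 2%:R) ->
  x n <= decay_bound a b (x 0) n%:R.
Proof.
move=> Ka Kb vx dec.
have x0 i : (i <= n)%N -> 0 <= x i by move=> /vx[].
have v0 i : (i <= n)%N -> 0 <= v i.
  by move=> /vx[xi av _]; apply: le_trans av; exact: class_K_ge0 Ka.1 xi.
have v_decr k i : (i + k = n)%N -> v n <= v i.
  elim: k i => [|k IH] i; first by rewrite addn0 => ->.
  rewrite -addSnnS => ik; have ilt : (i < n)%N by rewrite -ik ltnS leq_addr.
  apply: le_trans (IH _ ik) _; apply: le_trans (dec _ ilt) _.
  by rewrite gerBl divr_ge0// class_K_ge0 ?x0 ?(ltnW ilt)//; exact: Ka.1.
have s_le i : (i <= n)%N -> a (class_Kinv b (v n)) <= a (x i).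
  move=> ilt; have [xi _ vb] := vx i ilt.
  rewrite (class_K_le Ka.1) ?class_Kinv_ge0 ?v0// class_Kinv_ge ?v0//.
  by apply: le_trans vb; apply: (v_decr (n - i)%N); rewrite subnKC.
have sum_le i : (i <= n)%N ->
    v i + i%:R * a (class_Kinv b (v n)) / 2%:R <= v 0.
  elim: i => [|i IH] ilt; first by rewrite !mul0r addr0.
  have := IH (ltnW ilt); have := s_le i (ltnW ilt); have := dec i ilt.
  by rewrite -(natr1 i); lra.
have n1 : 0 < 1 + n%:R :> R by rewrite ltr_wpDr.
have [x00 _ vb0] := vx 0 (leq0n n); have [xn avn _] := vx n (leqnn n).
have w0 : 0 <= (a (x 0) + 2%:R * b (x 0)) / (1 + n%:R).
  rewrite divr_ge0 ?addr_ge0 ?mulr_ge0// ?class_K_ge0//; first exact: Ka.1.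
  exact: Kb.1.
have bw0 : 0 <= b (class_Kinv a ((a (x 0) + 2%:R * b (x 0)) / (1 + n%:R))).
  by rewrite class_K_ge0 ?class_Kinv_ge0//; exact: Kb.1.
rewrite /decay_bound class_Kinv_le//; apply: le_trans avn _.
rewrite -class_Kinv_ge ?class_Kinv_ge0 ?v0//.
rewrite class_Kinv_le ?class_Kinv_ge0 ?v0//.
rewrite ler_pdivlMr//.
have := sum_le n (leqnn n); have := s_le 0 (leq0n n); have := v0 n (leqnn n).
lra.
Qed.

End comparison_function_calculus.

(** * Random elements of separable spaces *)

Section random_elements.
Set Implicit Arguments.
Unset Strict Implicit.
Context {R : realType} {dO : measure_display} {Omega : measurableType dO}.

Lemma countable_bigcup_measurable (I : Type) (D : set I) (F : I -> set Omega) :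
  countable D -> (forall i, D i -> measurable (F i)) ->
  measurable (\bigcup_(i in D) F i).
Proof.
move=> /countable_injP[f finj] mF.
rewrite (_ : \bigcup_(i in D) F i =
  \bigcup_n \bigcup_(i in D `&` [set i | f i = n]) F i); last first.
  apply/seteqP; split=> w /=.
    by move=> [i Di Fiw]; exists (f i) => //; exists i.
  by move=> [n _ [i [Di _] Fiw]]; exists i.
apply: bigcupT_measurable => n.
have [[i [Di fi]]|noi] := pselect (exists i, (D `&` [set i | f i = n]) i).
  rewrite (_ : _ `&` _ = [set i]) ?bigcup_set1; first exact: mF.
  apply/seteqP; split=> k /=; last by move=> ->.
  by move=> [Dk fk]; apply: finj; rewrite ?inE// fk fi.
rewrite (_ : _ `&` _ = set0) ?bigcup_set0//.
by apply/seteqP; split=> i //= Di; apply: noi; exists i.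
Qed.

Lemma random_element_open (Z : topologicalType) (Y : Omega -> Z) :
  (forall O, open O -> measurable (Y @^-1` O)) -> random_element Y.
Proof.
move=> YO; pose G : set (set Z) := [set B | measurable (Y @^-1` B)].
apply: (smallest_sub (X := G)) => //.
split => [|A mA|A mA].
- by rewrite /G /= preimage_set0.
- by rewrite /G /= setTD preimage_setC; exact: measurableC.
- by rewrite /G /= preimage_bigcup; exact: bigcupT_measurable.
Qed.

Lemma random_element_preimage_open (Z : topologicalType) (Y : Omega -> Z) O :
  random_element Y -> open O -> measurable (Y @^-1` O).
Proof. by move=> mY oO; apply: mY; exact: sub_sigma_algebra. Qed.

Lemma separable_second_countable (Z : completeNormedModType R) :
  separable Z -> @second_countable Z.
Proof.
move=> [A cA dA].
pose f (p : Z * nat) : set Z := ball p.1 p.2.+1%:R^-1.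
exists (f @` (A `*` setT)).
  exact/(card_le_trans (card_image_le _ _))/countableX.
split=> [_ [p _ <-]|x V /nbhs_ballP[_/posnumP[eps] ballsubV]].
  exact: ball_open.
have [//|N] := @ltr_add_invr R 0%R (eps%:num/2) _; rewrite add0r => deleps.
have [|a [xa Aa]] := dA (ball x N.+1%:R^-1) _ (ball_open _ _).
  by exists x; exact: ballxx.
exists (f (a, N)); first by split; [exists (a, N)|exact: ball_sym].
apply: (subset_trans _ ballsubV) => z bz.
rewrite [_%:num]splitr; apply: (@ball_triangle _ _ a).
  exact: le_ball (ltW deleps) _ xa.
exact: le_ball (ltW deleps) _ bz.
Qed.

Lemma second_countable_prod (Z1 Z2 : topologicalType) :
  @second_countable Z1 -> @second_countable Z2 ->
  @second_countable (Z1 * Z2)%type.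
Proof.
move=> [B1 cB1 [oB1 bB1]] [B2 cB2 [oB2 bB2]].
exists ((fun p => p.1 `*` p.2) @` (B1 `*` B2)).
  exact/(card_le_trans (card_image_le _ _))/countableX.
split=> [_ [[G1 G2] [/oB1 oG1 /oB2 oG2] <-]|[x y] V].
  rewrite openE => -[x y] [/= G1x G2y]; exists (G1, G2) => //.
  by split; exact: open_nbhs_nbhs.
move=> [[V1 V2] /= [/bB1[G1 [BG1 G1x] G1V] /bB2[G2 [BG2 G2y] G2V]] VV].
exists (G1 `*` G2); first by split => //; exists (G1, G2).
by apply: subset_trans VV => -[a b] /= [? ?]; split; [exact: G1V|exact: G2V].
Qed.

(** Second countability makes every open set of the product a countable union
    of boxes, so that the Borel sets of the product are generated by boxes. *)
Lemma random_element_pair (Z1 Z2 : topologicalType)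
    (Y1 : Omega -> Z1) (Y2 : Omega -> Z2) :
  @second_countable Z1 -> @second_countable Z2 ->
  random_element Y1 -> random_element Y2 ->
  random_element (fun w => (Y1 w, Y2 w)).
Proof.
move=> [B1 cB1 [oB1 bB1]] [B2 cB2 [oB2 bB2]] mY1 mY2.
apply: random_element_open => O oO.
pose D := (B1 `*` B2) `&` [set p | p.1 `*` p.2 `<=` O].
rewrite (_ : _ @^-1` O = \bigcup_(p in D) (Y1 @^-1` p.1 `&` Y2 @^-1` p.2)).
  apply: countable_bigcup_measurable.
    by apply: sub_countable (countableX cB1 cB2); apply: subset_card_le => p [].
  move=> [G1 G2] [[/oB1 oG1 /oB2 oG2] _].
  by apply: measurableI; exact: random_element_preimage_open.
apply/seteqP; split=> w /=.
  move=> Ow; have : nbhs (Y1 w, Y2 w) O by exact: open_nbhs_nbhs.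
  move=> [[V1 V2] /= [/bB1[G1 [BG1 G1x] G1V] /bB2[G2 [BG2 G2y] G2V]] VV].
  exists (G1, G2) => //; split => //=.
  by apply: subset_trans VV => -[a b] /= [? ?]; split; [exact: G1V|exact: G2V].
by move=> [[G1 G2] [_ sO] [? ?]]; exact: sO.
Qed.

Lemma random_element_comp (Z1 Z2 : topologicalType) (f : Z1 -> Z2)
    (Y : Omega -> Z1) :
  continuous f -> random_element Y -> random_element (f \o Y).
Proof.
move=> cf mY; apply: random_element_open => O oO.
rewrite comp_preimage; apply: random_element_preimage_open => //.
by apply: open_comp => // x _; exact: cf.
Qed.

End random_elements.

(** * Inequalities in the extended reals *)

Section extended_reals.
Context {R : realType}.
Set Implicit Arguments.
Unset Strict Implicit.
Local Open Scope ereal_scope.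

Lemma er_map_class_K_ge0 (a : R -> R) (x : \bar R) :
  class_K a -> 0 <= x -> 0 <= er_map a x.
Proof. by move=> Ka; case: x => //= x; rewrite !lee_fin; exact: class_K_ge0. Qed.

Lemma er_map_le_class_Kinv (a : R -> R) (x : \bar R) (y : R) :
  class_Kinf a -> 0 <= x -> (0 <= y)%R ->
  (er_map a x <= y%:E) = (x <= (class_Kinv a y)%:E).
Proof.
move=> Ka; case: x => [x| |] //=; rewrite !lee_fin => x0 y0.
by rewrite -[in LHS](class_KinvK Ka y0) (class_K_le Ka.1)// class_Kinv_ge0.
Qed.

Lemma ereal_between (x : \bar R) (b : R) : 0 <= x -> x <= b%:E ->
  exists2 y, x = y%:E & (0 <= y <= b)%R.
Proof. by case: x => // x; rewrite !lee_fin => x0 xb; exists x; rewrite ?x0. Qed.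

Lemma lee_addl_ereal_inf (a : R) (b : \bar R) (S : set (\bar R)) :
  (forall x, S x -> b <= a%:E + x) -> b <= a%:E + ereal_inf S.
Proof.
move=> Sb; rewrite addeC -leeBlDr//; apply: le_ereal_inf_tmp => x /Sb.
by rewrite leeBlDr// addeC.
Qed.

Lemma exists_le_average (f : nat -> \bar R) (a m : nat) (B : R) : (0 < m)%N ->
  \sum_(a <= k < a + m) f k <= B%:E ->
  exists2 k, (a <= k < a + m)%N & f k <= (B / m%:R)%:E.
Proof.
move=> m0 sumf; apply: contrapT => nof.
have fgt k : (a <= k < a + m)%N -> (B / m%:R)%:E < f k.
  by move=> km; rewrite ltNge; apply/negP => fk; apply: nof; exists k.
suff : forall n, (n < m)%N ->
    (n.+1%:R * (B / m%:R))%:E < \sum_(a <= k < a + n.+1) f k.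
  move=> /(_ m.-1); rewrite prednK// leqnn => /(_ isT).
  by rewrite mulrCA divff ?mulr1 ?pnatr_eq0 -?lt0n// ltNge sumf.
elim=> [|n IH] nm.
  by rewrite mul1r addn1 big_nat1 fgt// leqnn -[ltnLHS]addn0 ltn_add2l.
rewrite addnS big_nat_recr ?leq_addr//= -natr1 mulrDl mul1r EFinD lteD ?IH//.
  exact: ltnW.
by rewrite fgt// leq_addr ltn_add2l.
Qed.

End extended_reals.

(** * Splitting trajectories, costs and values in time *)

Section trajectories.
Context {R : realType} {X U W : completeNormedModType R} {dO : measure_display}
  {Omega : measurableType dO} {P : probability Omega R}.
Set Implicit Arguments.
Unset Strict Implicit.
Variable sys : stochastic_ocp X U W P.
Local Open Scope ereal_scope.
Implicit Types (Y : Omega -> X) (v : Omega -> U) (Vs : nat -> Omega -> U).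
Implicit Types (c : nat -> (Omega -> X) -> (Omega -> U) -> \bar R).

Lemma trajD j Y Vs p k : traj sys j Y Vs (p + k) =
  traj sys (j + p) (traj sys j Y Vs p) (fun i => Vs (p + i)%N) k.
Proof. by elim: k => [|k IH]; rewrite ?addn0// addnS/= IH addnA. Qed.

Lemma eq_traj j Y Vs Vs' k : (forall i, (i < k)%N -> Vs i = Vs' i) ->
  traj sys j Y Vs k = traj sys j Y Vs' k.
Proof.
elim: k => //= k IH eqV; rewrite IH ?eqV// => i ik.
by rewrite eqV// ltnW.
Qed.

Lemma costD c p m j Y Vs : cost sys c (p + m) j Y Vs =
  cost sys c p j Y Vs +
  cost sys c m (j + p) (traj sys j Y Vs p) (fun i => Vs (p + i)%N).
Proof.
rewrite /cost; elim: m => [|m IH].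
  by rewrite addn0 [X in _ = _ + X]big_geq// adde0.
by rewrite addnS !big_nat_recr//= IH trajD addnA addeA.
Qed.

Lemma cost1 c j Y Vs : cost sys c 1 j Y Vs = c j Y (Vs 0%N).
Proof. by rewrite /cost big_nat1 addn0. Qed.

Lemma eq_cost c j Y Vs Vs' k : (forall i, (i < k)%N -> Vs i = Vs' i) ->
  cost sys c k j Y Vs = cost sys c k j Y Vs'.
Proof.
move=> eqV; apply: eq_big_nat => i /= ik; rewrite eqV//.
by congr c; apply: eq_traj => i' i'i; rewrite eqV// (ltn_trans i'i).
Qed.

Lemma Uad_finD p m j Y Vs : Uad_fin sys (p + m) j Y Vs ->
  Uad_fin sys p j Y Vs /\
  Uad_fin sys m (j + p) (traj sys j Y Vs p) (fun i => Vs (p + i)%N).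
Proof.
move=> adV; split=> k km; first by apply: adV; rewrite ltn_addr.
by rewrite -trajD; apply: adV; rewrite ltn_add2l.
Qed.

Lemma Uad_fin_leq p n j Y Vs : (p <= n)%N ->
  Uad_fin sys n j Y Vs -> Uad_fin sys p j Y Vs.
Proof. by move=> pn adV k kp; apply: adV; exact: leq_trans pn. Qed.

Definition splice (p : nat) Vs Vs' : nat -> Omega -> U :=
  fun k => if (k < p)%N then Vs k else Vs' (k - p)%N.

Lemma splice_head p Vs Vs' i : (i < p)%N -> splice p Vs Vs' i = Vs i.
Proof. by rewrite /splice => ->. Qed.

Lemma splice_tail p Vs Vs' : (fun i => splice p Vs Vs' (p + i)%N) = Vs'.
Proof. by apply/funext => i; rewrite /splice ltnNge leq_addr/= addKn. Qed.

Lemma Uad_fin_splice p m j Y Vs Vs' : Uad_fin sys p j Y Vs ->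
  Uad_fin sys m (j + p) (traj sys j Y Vs p) Vs' ->
  Uad_fin sys (p + m) j Y (splice p Vs Vs').
Proof.
move=> adV adV' k km; have [kp|pk] := ltnP k p.
  rewrite splice_head// (@eq_traj j Y _ Vs); first exact: adV.
  by move=> i ik; rewrite splice_head// (ltn_trans ik).
rewrite -(subnKC pk) trajD (@eq_traj j Y _ Vs); last first.
  by move=> i ik; rewrite splice_head.
rewrite splice_tail (_ : splice _ _ _ _ = Vs' (k - p)%N).
  by apply: adV'; rewrite ltn_subLR.
by rewrite -[in RHS](splice_tail p Vs Vs').
Qed.

(** Half of the dynamic programming principle: the admissibility of a control
    depends on the current state only, so that admissible controls can be
    concatenated. *)
Lemma value_le_cost_value c p m j Y Vs : Uad_fin sys p j Y Vs ->
  cost sys c p j Y Vs \is a fin_num ->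
  value sys c (p + m) j Y <=
  cost sys c p j Y Vs + value sys c m (j + p) (traj sys j Y Vs p).
Proof.
move=> adV; case costE: (cost sys c p j Y Vs) => [a| |]// _.
apply: lee_addl_ereal_inf => _ [Vs' adV' <-].
apply: ereal_inf_lbound; exists (splice p Vs Vs'); first exact: Uad_fin_splice.
rewrite costD splice_tail (@eq_cost _ _ _ _ Vs); last first.
  by move=> i ip; rewrite splice_head.
by rewrite (@eq_traj j Y _ Vs) ?costE// => i ip; rewrite splice_head.
Qed.

(** The tail of an admissible control sequence competes for the value at the
    state reached. *)
Lemma cost_value_le_cost c p m j Y Vs : Uad_fin sys (p + m) j Y Vs ->
  cost sys c p j Y Vs + value sys c m (j + p) (traj sys j Y Vs p) <=
  cost sys c (p + m) j Y Vs.
Proof.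
move=> /Uad_finD[_ adV]; rewrite costD leeD2l//.
by apply: ereal_inf_lbound; exists (fun i => Vs (p + i)%N).
Qed.

End trajectories.

(** * Invariance of the admissible states *)

Section admissible_states.
Context {R : realType} {X U W : completeNormedModType R} {dO : measure_display}
  {Omega : measurableType dO} {P : probability Omega R}.
Set Implicit Arguments.
Unset Strict Implicit.
Variable sys : stochastic_ocp X U W P.
Hypotheses (sepX : separable X) (sepU : separable U) (sepW : separable W).
Implicit Types (Y : Omega -> X) (v : Omega -> U) (Vs : nat -> Omega -> U).

(** The independence of future noise is inherited because an admissible control
    sequence of the next state can be preceded by [v]. Separability makes the
    triple of state, control and noise a random element of the product. *)
Lemma state_step j Y v : state sys j Y -> Uad sys Y v ->
  state sys j.+1 (step sys j Y v).
Proof.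
move=> [rY indY] adv; have [rv _ _] := adv; split.
  apply: (@random_element_comp _ _ _ _ (dyn sys)
    (fun w => (Y w, v w, noise sys j w))).
    exact: dyn_continuous.
  have [scX scU scW] : [/\ @second_countable X, @second_countable U &
      @second_countable W] by split; exact: separable_second_countable.
  apply: random_element_pair => //; last exact: noise_random.
    exact: second_countable_prod.
  exact: random_element_pair.
move=> Vs adVs k.
pose Vs' i := if i is i'.+1 then Vs i' else v.
have trajS i : traj sys j Y Vs' i.+1 = traj sys j.+1 (step sys j Y v) Vs i.
  by rewrite -add1n trajD addn1/= addn0.
have := indY Vs' _ k.+1; rewrite trajS addnS; apply=> -[//|i].
by rewrite trajS; exact: adVs.
Qed.

Lemma state_traj N j Y Vs : state sys j Y -> Uad_fin sys N j Y Vs ->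
  forall k, (k <= N)%N -> state sys (j + k) (traj sys j Y Vs k).
Proof.
move=> sY adVs; elim=> [|k IH] kN; first by rewrite addn0.
by rewrite addnS; apply: state_step; [exact: IH (ltnW kN)|exact: adVs].
Qed.

End admissible_states.

(** * Modified costs of a dissipative system *)

Section dissipative_system.
Context {R : realType} {X U W : completeNormedModType R} {dO : measure_display}
  {Omega : measurableType dO} {P : probability Omega R}.
Set Implicit Arguments.
Unset Strict Implicit.
Variable sys : stochastic_ocp X U W P.
Hypotheses (sepX : separable X) (sepU : separable U) (sepW : separable W).
Variables (d : (Omega -> X) -> (Omega -> X) -> \bar R).
Variables (Xs : nat -> Omega -> X) (Us : nat -> Omega -> U).
Variables (lambda : nat -> (Omega -> X) -> R) (alpha : R -> R).
Hypotheses (d_pm : pseudometric d) (statXU : stationary_pair sys Xs Us).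
Hypothesis (ell_s_fin : ell_s sys Xs Us \is a fin_num).
Hypothesis (diss : strictly_dissipative sys Xs Us d lambda alpha).
Hypothesis (ell_tilde0 :
  forall j, ell_tilde sys Xs Us lambda j (Xs j) (Us j) = 0%E).
Local Open Scope ereal_scope.
Implicit Types (Y : Omega -> X) (v : Omega -> U) (Vs : nat -> Omega -> U).

Local Notation ls := (fine (ell_s sys Xs Us)).
Local Notation tl := (ell_tilde sys Xs Us lambda).
Local Notation Vt := (V_tilde sys Xs Us lambda).

(** The storage function telescopes along trajectories. The identity holds
    even for infinite costs, as all the other summands are real. *)
Lemma cost_tildeE N j Y Vs : cost sys tl N j Y Vs = J sys N j Y Vs +
  (lambda j Y - lambda (j + N)%N (traj sys j Y Vs N) - N%:R * ls)%:E.
Proof.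
rewrite /J; elim: N => [|N IH].
  by rewrite /cost !big_geq// addn0/= subrr mul0r subr0 add0e.
rewrite -addn1 !costD IH !cost1.
have -> v' Y' i : tl i Y' v' = ell sys Y' v' +
    (lambda i Y' - lambda i.+1 (step sys i Y' v') - ls)%:E.
  rewrite /ell_tilde -{1}(fineK ell_s_fin) -!addeA -!EFinN -!EFinD.
  by congr (_ + _%:E); ring.
rewrite addeACA -EFinD; congr (_ + _%:E).
by rewrite !addn0 addn1 /= addnS -natr1; ring.
Qed.

Lemma d_ge0 j j' Y : state sys j Y -> state sys j' (Xs j') ->
  0 <= d Y (Xs j').
Proof. by move=> [rY _] [rX _]; have [d0 _ _ _] := d_pm; exact: d0. Qed.

Lemma traj_stationary j k :
  traj sys j (Xs j) (fun i => Us (j + i)%N) k = Xs (j + k)%N.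
Proof.
have [_ _ stepX _] := statXU.
by elim: k => [|k IH]; rewrite ?addn0// addnS stepX -IH.
Qed.

Lemma Uad_stationary j : Uad sys (Xs j) (Us j).
Proof.
have [_ adU _ _] := statXU.
by have := adU j; rewrite (traj_stationary 0 j).
Qed.

Lemma state_stationary j : state sys j (Xs j).
Proof.
have [sX _ stepX _] := statXU; elim: j => // j IH.
by rewrite stepX; apply: state_step => //; exact: Uad_stationary.
Qed.

Lemma dist_stationary_ge0 j j' Y : state sys j Y -> 0 <= d Y (Xs j').
Proof. by move=> sY; apply: d_ge0 sY _; exact: state_stationary. Qed.

Lemma dist_stationary0 j : d (Xs j) (Xs j) = 0.
Proof. by have [_ d0 _ _] := d_pm; apply: d0; have [] := state_stationary j. Qed.

Lemma cl_ball_stationary (r : R) j : (0 <= r)%R ->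
  cl_ball sys Xs d r%:E j (Xs j).
Proof. by split; [exact: state_stationary|rewrite dist_stationary0 lee_fin]. Qed.

Lemma ell_tilde_ge0 j Y v : state sys j Y -> Uad sys Y v -> 0 <= tl j Y v.
Proof.
have [_ [Ka _] le_tl] := diss => sY adv.
apply: le_trans (le_tl _ _ _ sY adv); apply: er_map_class_K_ge0 => //.
exact: dist_stationary_ge0 sY.
Qed.

Lemma ell_tilde_traj_ge0 N j Y Vs k : state sys j Y -> Uad_fin sys N j Y Vs ->
  (k < N)%N -> 0 <= tl (j + k) (traj sys j Y Vs k) (Vs k).
Proof.
move=> sY adV kN; apply: ell_tilde_ge0; last exact: adV.
by apply: (state_traj sepX sepU sepW sY adV); exact: ltnW.
Qed.

Lemma cost_tilde_ge0 N j Y Vs : state sys j Y -> Uad_fin sys N j Y Vs ->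
  0 <= cost sys tl N j Y Vs.
Proof.
move=> sY adV; rewrite /cost big_seq; apply: sume_ge0 => k.
by rewrite mem_index_iota => kN; exact: ell_tilde_traj_ge0 sY adV _.
Qed.

Lemma cost_tilde_le M N j Y Vs : state sys j Y -> Uad_fin sys N j Y Vs ->
  (M <= N)%N -> cost sys tl M j Y Vs <= cost sys tl N j Y Vs.
Proof.
move=> sY + MN; rewrite -(subnKC MN) => adV.
have [adM adNM] := Uad_finD adV; rewrite costD leeDl//.
apply: cost_tilde_ge0 => //.
exact: state_traj sepX sepU sepW _ _ _ _ sY adM _ _.
Qed.

Lemma V_tilde_ge0 N j Y : state sys j Y -> 0 <= Vt N j Y.
Proof.
by move=> sY; apply: le_ereal_inf_tmp => _ [Vs adV <-]; exact: cost_tilde_ge0.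
Qed.

Lemma V_tilde_le M N j Y : state sys j Y -> (M <= N)%N -> Vt M j Y <= Vt N j Y.
Proof.
move=> sY MN; apply: le_ereal_inf_tmp => _ [Vs adV <-].
apply: le_trans (cost_tilde_le sY adV MN).
by apply: ereal_inf_lbound; exists Vs => //; exact: Uad_fin_leq adV.
Qed.

Lemma alpha_dist_le_V_tilde N j Y : (0 < N)%N -> state sys j Y ->
  er_map alpha (d Y (Xs j)) <= Vt N j Y.
Proof.
move=> N0 sY; apply: le_trans (V_tilde_le sY N0).
apply: le_ereal_inf_tmp => _ [Vs adV <-]; rewrite cost1.
by have [_ _ le_tl] := diss; apply: le_tl => //; exact: (adV 0%N).
Qed.

Lemma V_tilde_stationary N j : Vt N j (Xs j) = 0.
Proof.
apply/eqP; rewrite eq_le V_tilde_ge0 ?andbT; last exact: state_stationary.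
apply: ereal_inf_lbound; exists (fun i => Us (j + i)%N).
  by move=> k _; rewrite traj_stationary; exact: Uad_stationary.
by rewrite /cost big1// => k _; rewrite traj_stationary.
Qed.

(** The modified stage costs are nonnegative and dominate [alpha] of the
    distance. Among [m] consecutive times there is one at which their sum along
    both trajectories is at most its average. A single time has to serve both
    trajectories, since their tails are compared there. *)
Lemma common_turnpike_time N a m (A B : R) j Y Vs Vs' :
  state sys j Y -> Uad_fin sys N j Y Vs -> Uad_fin sys N j Y Vs' ->
  cost sys tl N j Y Vs <= A%:E -> cost sys tl N j Y Vs' <= B%:E ->
  (0 < m)%N -> (a + m <= N)%N ->
  exists p, [/\ (a <= p < a + m)%N,
    d (traj sys j Y Vs p) (Xs (j + p)%N) <=
      (class_Kinv alpha ((A + B) / m%:R))%:E &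
    d (traj sys j Y Vs' p) (Xs (j + p)%N) <=
      (class_Kinv alpha ((A + B) / m%:R))%:E].
Proof.
move=> sY adV adV' leA leB m0 amN.
pose f k := tl (j + k) (traj sys j Y Vs k) (Vs k) +
  tl (j + k) (traj sys j Y Vs' k) (Vs' k).
have f0 k : (k < N)%N -> 0 <= f k.
  by move=> kN; apply: adde_ge0; [exact: ell_tilde_traj_ge0 sY adV _|
    exact: ell_tilde_traj_ge0 sY adV' _].
have [p apm] : exists2 p, (a <= p < a + m)%N & f p <= ((A + B) / m%:R)%:E.
  apply: exists_le_average => //.
  apply: (@le_trans _ _ (\sum_(0 <= k < N) f k)); last first.
    by rewrite big_split EFinD leeD.
  have aN : (a <= N)%N by lia.
  rewrite (big_cat_nat (leq0n a) aN)/= (big_cat_nat (leq_addr m a) amN)/=.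
  apply: (@le_trans _ _ (\sum_(a <= k < a + m) f k + \sum_(a + m <= k < N) f k)).
    rewrite leeDl// big_seq; apply: sume_ge0 => k.
    by rewrite mem_index_iota => kN; apply: f0; lia.
  rewrite leeDr// big_seq; apply: sume_ge0 => k.
  by rewrite mem_index_iota => kN; apply: f0; lia.
move=> fp; exists p; have pN : (p < N)%N by lia.
have AB0 : (0 <= (A + B) / m%:R)%R by rewrite -lee_fin (le_trans _ fp)// f0.
have [_ Ka le_tl] := diss.
have sT := state_traj sepX sepU sepW sY.
split=> //.
- rewrite -er_map_le_class_Kinv//; last first.
    exact: dist_stationary_ge0 (sT _ _ adV _ (ltnW pN)).
  apply: le_trans fp.
  apply: le_trans (le_tl _ _ _ (sT _ _ adV _ (ltnW pN)) (adV _ pN)) _.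
  by rewrite leeDl// (ell_tilde_traj_ge0 sY adV').
- rewrite -er_map_le_class_Kinv//; last first.
    exact: dist_stationary_ge0 (sT _ _ adV' _ (ltnW pN)).
  apply: le_trans fp.
  apply: le_trans (le_tl _ _ _ (sT _ _ adV' _ (ltnW pN)) (adV' _ pN)) _.
  by rewrite leeDr// (ell_tilde_traj_ge0 sY adV).
Qed.

(** * Turnpike property and decrease of the modified value *)

Variables (r Clam Clow CV : R).
Hypothesis (lambda_bnd :
  forall j Y, cl_ball sys Xs d r%:E j Y -> (`|lambda j Y| <= Clam)%R).
Hypothesis (lambda_low : forall j Y, state sys j Y -> (- Clow <= lambda j Y)%R).
Hypothesis (cheap : cheaply_reachable sys Xs Us d r CV).

(** Cheap reachability bounds the value from above; nonnegative modified costs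
    and the bounds on the storage function bound it from below. *)
Lemma V_fin_num N j Y : (0 < N)%N -> cl_ball sys Xs d r%:E j Y ->
  V sys N j Y \is a fin_num.
Proof.
move=> N0 Yr; have [sY _] := Yr.
have lowV : (N%:R * ls - lambda j Y - Clow)%:E <= V sys N j Y.
  apply: le_ereal_inf_tmp => _ [Vs adV <-].
  have := cost_tilde_ge0 sY adV; rewrite cost_tildeE -/(J sys N j Y Vs).
  have := lambda_low (state_traj sepX sepU sepW sY adV (leqnn N)).
  case: (J sys N j Y Vs) => [x| |]//; last by move=> *; exact: leey.
  rewrite -EFinD !lee_fin; lra.
have upV := cheap N0 Yr; rewrite -(fineK ell_s_fin) -EFinM in upV.
rewrite leeBlDr// -EFinD in upV.
by rewrite fin_numElt (lt_le_trans (ltNyr _) lowV) (le_lt_trans upV (ltry _)).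
Qed.

(** The bound is uniform in [N], so that long optimal trajectories are close to
    stationarity most of the time. *)
Lemma cost_tilde_optimal_le N j Y Vs : (0 < N)%N -> cl_ball sys Xs d r%:E j Y ->
  Uad_fin sys N j Y Vs -> J sys N j Y Vs = V sys N j Y ->
  cost sys tl N j Y Vs <= (Clam + Clow + CV)%:E.
Proof.
move=> N0 Yr adV optV; have [sY _] := Yr; rewrite cost_tildeE optV.
have := cheap N0 Yr; rewrite -(fineK ell_s_fin) -EFinM.
have := lambda_low (state_traj sepX sepU sepW sY adV (leqnn N)).
have := lambda_bnd Yr; rewrite ler_norml => /andP[_].
rewrite -(fineK (V_fin_num N0 Yr)) -EFinN -!EFinD !lee_fin; lra.
Qed.

Hypotheses (Clam_gt0 : (0 < Clam)%R) (Clow_gt0 : (0 < Clow)%R)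
  (CV_gt0 : (0 < CV)%R).
Variables (mu : nat -> nat -> (Omega -> X) -> (Omega -> U)).
Hypothesis (mu_mpc : mpc_feedback sys mu).
Variables (eps : R) (gV : R -> R -> R).
Hypothesis (gV_ge0 :
  forall s rho, (0 <= s -> 0 <= rho -> 0 <= gV s rho)%R).
Hypothesis (gV_mono : forall rho, (0 <= rho)%R ->
  (forall s t, (0 <= s -> s <= t -> gV t rho <= gV s rho)%R) \/
  (forall s t, (0 <= s -> s <= t -> gV s rho <= gV t rho)%R)).
Hypothesis (gV_ndecr : forall s rho rho',
  (0 <= s -> 0 <= rho -> rho <= rho' -> gV s rho <= gV s rho')%R).
Hypothesis (V_cont : forall N j Y, (0 < N)%N -> cl_ball sys Xs d eps%:E j Y ->
  `|V sys N j Y - V sys N j (Xs j)| <= er_map (gV N%:R) (d Y (Xs j))).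
Variables (epst rt : R) (glam gtV : R -> R).
Hypothesis (epst_le : (epst <= rt)%R).
Hypotheses (glam_Kinf : class_Kinf glam) (gtV_Kinf : class_Kinf gtV).
Hypothesis (lambda_cont : forall j Y, cl_ball sys Xs d epst%:E j Y ->
  (`|lambda j Y - lambda j (Xs j)|)%:E <= er_map glam (d Y (Xs j))).
Hypothesis (V_tilde_cont : forall N j Y, (0 < N)%N ->
  cl_ball sys Xs d rt%:E j Y ->
  `|Vt N j Y - Vt N j (Xs j)| <= er_map gtV (d Y (Xs j))).

Local Notation C := (Clam + Clow + CV)%R.

Lemma cl_ballP rho j Y : cl_ball sys Xs d rho%:E j Y ->
  exists2 x, d Y (Xs j) = x%:E & (0 <= x <= rho)%R.
Proof.
by move=> [sY dY]; apply: ereal_between => //; exact: dist_stationary_ge0 sY.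
Qed.

Lemma sub_cl_ball (a b : R) j Y : (a <= b)%R ->
  cl_ball sys Xs d a%:E j Y -> cl_ball sys Xs d b%:E j Y.
Proof. by move=> ab [sY dY]; split=> //; rewrite (le_trans dY)// lee_fin. Qed.

Lemma lambda_near_stationary rho j Y : (rho <= epst)%R ->
  cl_ball sys Xs d rho%:E j Y ->
  (`|lambda j Y - lambda j (Xs j)| <= glam rho)%R.
Proof.
move=> rhoe Yr; have := lambda_cont (sub_cl_ball rhoe Yr).
have [x -> /andP[x0 xr]] := cl_ballP Yr; rewrite /= lee_fin => /le_trans; apply.
by rewrite (class_K_le glam_Kinf.1)// (le_trans x0).
Qed.

Lemma V_tilde_le_dist rho j Y N : (0 < N)%N -> (rho <= rt)%R ->
  cl_ball sys Xs d rho%:E j Y -> Vt N j Y <= er_map gtV (d Y (Xs j)).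
Proof.
move=> N0 rhort Yr; have := V_tilde_cont N0 (sub_cl_ball rhort Yr).
have [sY _] := Yr.
by rewrite V_tilde_stationary sube0 gee0_abs// V_tilde_ge0.
Qed.

Lemma V_tilde_near_stationary rho j Y N : (0 < N)%N -> (rho <= rt)%R ->
  cl_ball sys Xs d rho%:E j Y -> Vt N j Y <= (gtV rho)%:E.
Proof.
move=> N0 rhort Yr; have := V_tilde_le_dist N0 rhort Yr.
have [x -> /andP[x0 xr]] := cl_ballP Yr; move=> /le_trans; apply.
by rewrite lee_fin (class_K_le gtV_Kinf.1)// (le_trans x0).
Qed.

Lemma V_near_stationary rho j Y N : (0 < N)%N -> (rho <= r)%R ->
  (rho <= eps)%R -> cl_ball sys Xs d rho%:E j Y ->
  (`|fine (V sys N j Y) - fine (V sys N j (Xs j))| <= gV N%:R rho)%R.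
Proof.
move=> N0 rhor rhoe Yr; have := V_cont N0 (sub_cl_ball rhoe Yr).
have [x dx /andP[x0 xr]] := cl_ballP Yr.
rewrite -(fineK (V_fin_num N0 (sub_cl_ball rhor Yr))) -[X in _ - X]fineK.
  rewrite -EFinN -EFinD /= dx /= lee_fin => /le_trans; apply.
  exact: gV_ndecr.
apply: V_fin_num => //; apply: cl_ball_stationary => //.
by apply: le_trans rhor; exact: le_trans xr.
Qed.

(** Let [p] be a time at which both the optimal trajectory and one that nearly
    minimizes the modified cost are close to stationarity. Up to [p] both have
    nearly the same modified cost: optimality compares their costs, and the
    tails and the storage functions differ by little. After the first step the
    optimal trajectory up to [p], followed by a tail of small modified cost, is
    a candidate for the next optimization problem. *)
Lemma V_tilde_decrease N j Y (th := vartheta alpha C (N%:R / 12%:R)) :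
  (1 < N)%N -> cl_ball sys Xs d r%:E j Y ->
  (th <= r)%R -> (th <= eps)%R -> (th <= epst)%R ->
  tl j Y (mu N j Y) + Vt N j.+1 (cl_step sys (mu N) j Y) <=
  Vt N j Y + (nu alpha gtV glam gV C N)%:E.
Proof.
move=> N1 Yr thr the thet; have [sY _] := Yr.
have N0 : (0 < N)%N by exact: ltnW.
have [_ Ka le_tl] := diss.
have C0 : (0 < C)%R by rewrite !addr_gt0.
have CN0 : (0 <= C / (N%:R / 12%:R))%R by rewrite !divr_ge0// ltW.
have th0 : (0 < th)%R.
  have [_ _ alpha0] := Ka.1.
  by rewrite /th /vartheta class_Kinv_lt// alpha0 !divr_gt0// ltr0n.
have gth0 : (0 < gtV th)%R.
  by have [_ gtV_incr gtV0] := gtV_Kinf.1; rewrite -gtV0 gtV_incr.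
have [Vs adV [optV muE]] := mu_mpc N0 sY.
have costV := cost_tilde_optimal_le N0 Yr adV optV.
have [y Vty /andP[y0 yC]] : exists2 y, Vt N j Y = y%:E & (0 <= y <= C)%R.
  apply: ereal_between; first exact: V_tilde_ge0.
  by apply: le_trans costV; apply: ereal_inf_lbound; exists Vs.
(* [nu N] has room for the error [gtV th], so that a minimizer up to [gtV th]
   of the modified cost is good enough; the cap [C] keeps that cost below
   [2 * C]. *)
pose eta := Num.min C (gtV th).
have [etaC etag] : (eta <= C)%R /\ (eta <= gtV th)%R.
  by rewrite /eta !ge_min !lexx orbT.
have eta0 : (0 < eta)%R by rewrite lt_min C0.
have [_ [Vq adVq <-]/ltW costq] : exists2 x,
    [set cost sys tl N j Y Vs | Vs in Uad_fin sys N j Y] x & x < (y + eta)%:E.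
  apply: ereal_inf_lt; rewrite -/(value _ _ _ _ _) -/(Vt N j Y) Vty.
  by rewrite lte_fin ltrDl.
(* The window for [p] is chosen so that the length [N - p] of the tail is on the
   side of [N / 2] where the monotonicity of [gV ^~ th] helps. *)
have [a [a0 aN ga]] : exists a, [/\ (0 < a)%N, (a + N./2 <= N)%N &
    forall p, (a <= p < a + N./2)%N ->
      (gV (N - p)%:R th <= gV (N%:R / 2%:R) th)%R].
  have [decr|incr] := gV_mono (ltW th0).
    exists 1%N; split=> [//||p pN]; first by move: N1; clear; lia.
    apply: decr; first by rewrite divr_ge0.
    by rewrite ler_pdivrMr// -natrM ler_nat; move: N1 pN; clear; lia.
  exists (N - N./2)%N; split; [move: N1; clear; lia..|] => p pN.
  apply: incr => //.
  by rewrite ler_pdivlMr// -natrM ler_nat; move: N1 pN; clear; lia.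
have N2 : (0 < N./2)%N by move: N1; clear; lia.
have costq2 : cost sys tl N j Y Vq <= (C + C)%:E.
  by apply: le_trans costq _; rewrite lee_fin lerD.
have [p [apN ds dq]] := common_turnpike_time sY adV adVq costV costq2 N2 aN.
(* The modified costs add up to at most [3 * C], and [N <= 4 * N./2]; this is
   where the fraction [N / 12] comes from. *)
have le_th : (class_Kinv alpha ((C + (C + C)) / N./2%:R) <= th)%R.
  have C3 : (0 <= (C + (C + C)) / N./2%:R)%R by rewrite divr_ge0//; lra.
  rewrite (class_K_le (class_K_inv Ka))//.
  have N4 : (N%:R <= 4%:R * N./2%:R :> R)%R.
    by rewrite -natrM ler_nat; move: N1; clear; lia.
  have NN : (0 < N%:R :> R)%R by rewrite ltr0n.
  have NN2 : (0 < N./2%:R :> R)%R by rewrite ltr0n.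
  rewrite invf_div mulrA ler_pdivrMr// mulrAC ler_pdivlMr//.
  have := ler_wpM2l (ltW C0) N4; lra.
rewrite -lee_fin in le_th.
have {ds}ds := le_trans ds le_th; have {dq}dq := le_trans dq le_th.
pose M := (N - p)%N.
have M0 : (0 < M)%N by rewrite /M; move: apN aN; clear; lia.
have pN : (p <= N)%N by move: apN aN; clear; lia.
have NpM : N = (p + M)%N by rewrite subnKC.
have sT := state_traj sepX sepU sepW sY.
set Zs := traj sys j Y Vs p in ds *; set Zq := traj sys j Y Vq p in dq *.
have bs : cl_ball sys Xs d th%:E (j + p) Zs by split => //; exact: sT adV _ pN.
have bq : cl_ball sys Xs d th%:E (j + p) Zq by split => //; exact: sT adVq _ pN.
have gVM : (gV M%:R th <= gV (N%:R / 2%:R) th)%R by apply: ga.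
have Vs_near := le_trans (V_near_stationary M0 thr the bs) gVM.
have Vq_near := le_trans (V_near_stationary M0 thr the bq) gVM.
have ls_near := lambda_near_stationary thet bs.
have lq_near := lambda_near_stationary thet bq.
have Vsf := V_fin_num M0 (sub_cl_ball thr bs).
have Vqf := V_fin_num M0 (sub_cl_ball thr bq).
have VNf := V_fin_num N0 Yr.
have adVp := Uad_fin_leq pN adV; have adVqp := Uad_fin_leq pN adVq.
have [cs cse /andP[cs0 _]] := ereal_between (cost_tilde_ge0 sY adVp)
  (le_trans (cost_tilde_le sY adV pN) costV).
have [cq cqe /andP[cq0 cqy]] := ereal_between (cost_tilde_ge0 sY adVqp)
  (le_trans (cost_tilde_le sY adVq pN) costq).
have JE Vr x : cost sys tl p j Y Vr = x%:E -> J sys p j Y Vr =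
    (x - (lambda j Y - lambda (j + p)%N (traj sys j Y Vr p) - p%:R * ls))%:E.
  rewrite cost_tildeE; case: (J sys p j Y Vr) => // z [<-].
  by congr (_%:E); ring.
have opt_lower : J sys p j Y Vs + V sys M (j + p) Zs <= V sys N j Y.
  rewrite -optV [in leRHS]NpM; apply: cost_value_le_cost.
  by rewrite -NpM.
have opt_upper : V sys N j Y <= J sys p j Y Vq + V sys M (j + p) Zq.
  rewrite [in leLHS]NpM; apply: value_le_cost_value => //.
  by rewrite -/(J _ _ _ _ _) (JE _ _ cqe).
move: opt_lower opt_upper.
rewrite (JE _ _ cse) (JE _ _ cqe) -(fineK Vsf) -(fineK Vqf) -(fineK VNf).
rewrite -!EFinD !lee_fin -/Zs -/Zq => opt_lower opt_upper.
have cs_le : (cs <= y + eta + 2%:R * gV (N%:R / 2%:R) th + 2%:R * glam th)%R.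
  move: Vs_near Vq_near ls_near lq_near; rewrite !ler_norml.
  move=> /andP[? ?] /andP[? ?] /andP[? ?] /andP[? ?]; lra.
(* From here on the first step is split off the optimal trajectory up to [p]. *)
have pq : p = (1 + p.-1)%N.
  by rewrite add1n prednK// (leq_trans a0)//; case/andP: apN.
have [adV1 adVq'] : Uad_fin sys 1 j Y Vs /\ Uad_fin sys p.-1 (j + 1)
    (traj sys j Y Vs 1) (fun i => Vs (1 + i)%N).
  by apply: Uad_finD; rewrite -pq.
have step1 : traj sys j Y Vs 1 = cl_step sys (mu N) j Y.
  by rewrite /= /cl_step addn0 muE.
have trajZ : traj sys (j + 1) (traj sys j Y Vs 1)
    (fun i => Vs (1 + i)%N) p.-1 = Zs.
  by rewrite -trajD -pq.
have s1 : state sys (j + 1) (traj sys j Y Vs 1) by exact: sT adV1 _ (leqnn 1).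
move: cse; rewrite [in X in X -> _]pq costD cost1 => cse.
have t0 : 0 <= tl j Y (Vs 0%N) by apply: ell_tilde_ge0 => //; exact: (adV 0%N).
have c0 := cost_tilde_ge0 s1 adVq'.
have [t te /andP[t0' _]] : exists2 t, tl j Y (Vs 0%N) = t%:E & (0 <= t <= cs)%R.
  by apply: ereal_between => //; rewrite -cse leeDl.
have [c1 ce /andP[c10 _]] : exists2 c1, cost sys tl p.-1 (j + 1)
    (traj sys j Y Vs 1) (fun i => Vs (1 + i)%N) = c1%:E & (0 <= c1 <= cs)%R.
  by apply: ereal_between => //; rewrite -cse leeDr.
have tail : Vt N j.+1 (cl_step sys (mu N) j Y) <= (c1 + gtV th)%:E.
  rewrite -step1 -addn1 [X in Vt X](_ : N = p.-1 + M.+1)%N; last first.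
    by rewrite addnS -addSn -[p.-1.+1]pq.
  apply: le_trans (value_le_cost_value _ adVq' _) _; first by rewrite ce.
  rewrite ce EFinD leeD2l// trajZ -addnA -pq.
  by apply: V_tilde_near_stationary bs => //; exact: le_trans epst_le.
apply: (@le_trans _ _ (t%:E + (c1 + gtV th)%:E)).
  by rewrite muE te leeD2l.
move: cse; rewrite te ce Vty -!EFinD !lee_fin /nu -/th => -[cse].
have gN0 : (0 <= gV (N%:R / 2%:R) th)%R by rewrite gV_ge0 ?divr_ge0// ltW.
have gl0 : (0 <= glam th)%R by rewrite (class_K_ge0 glam_Kinf.1)// ltW.
lra.
Qed.

(** * The closed loop *)

(* A radius within which all local assumptions hold. *)
Variable rho : R.
Hypotheses (rho_gt0 : (0 < rho)%R) (rho_r : (rho <= r)%R)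
  (rho_eps : (rho <= eps)%R) (rho_epst : (rho <= epst)%R).

Local Notation nuN N := (nu alpha gtV glam gV C N).
Local Notation thN N := (vartheta alpha C (N%:R / 12%:R)).
Local Notation Yset N := (V_tilde_preim sys Xs Us lambda N (alpha rho)).

Lemma C_gt0 : (0 < C)%R.
Proof. by rewrite !addr_gt0. Qed.

Lemma alpha_Kinf : class_Kinf alpha.
Proof. by case: diss. Qed.

Lemma vartheta_ge0 N : (0 <= thN N)%R.
Proof.
by rewrite class_Kinv_ge0 ?divr_ge0//; [exact: alpha_Kinf|exact/ltW/C_gt0].
Qed.

Lemma nu_ge0 N : (0 <= nuN N)%R.
Proof.
have th0 := vartheta_ge0 N.
by rewrite /nu !addr_ge0 ?mulr_ge0// ?(class_K_ge0 gtV_Kinf.1)//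
  ?(class_K_ge0 glam_Kinf.1)// gV_ge0// divr_ge0.
Qed.

(** The value below which the error [nu N] may outweigh the decrease
    [alpha (d Y (Xs j))], increased by the possible growth in one step. *)
Definition residual N : R :=
  (gtV (class_Kinv alpha (2%:R * nuN N)) + nuN N)%R.

Section fixed_horizon.
Variable N : nat.
Hypotheses (N1 : (1 < N)%N) (thN_rho : (thN N <= rho)%R).

Let N0 : (0 < N)%N := ltnW N1.

Lemma state_cl_step j Y : state sys j Y -> Uad sys Y (mu N j Y) ->
  state sys j.+1 (cl_step sys (mu N) j Y).
Proof. exact: state_step. Qed.

Lemma mpc_admissible j Y : state sys j Y -> Uad sys Y (mu N j Y).
Proof. by move=> sY; have [Vs adV [_ ->]] := mu_mpc N0 sY; exact: (adV 0%N). Qed.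

(** A step of the closed loop in real numbers. In a sublevel set the modified
    value is finite, and so are the other quantities by [V_tilde_decrease]. *)
Lemma closed_loop_step j Y : Yset N j Y ->
  [/\ state sys j.+1 (cl_step sys (mu N) j Y), cl_ball sys Xs d rho%:E j Y &
  exists x v v' t : R, [/\ d Y (Xs j) = x%:E, Vt N j Y = v%:E,
    Vt N j.+1 (cl_step sys (mu N) j Y) = v'%:E & tl j Y (mu N j Y) = t%:E] /\
  [/\ (0 <= x)%R, (alpha x <= v <= gtV x)%R, (0 <= v')%R, (alpha x <= t)%R &
    (t + v' <= v + nuN N)%R]].
Proof.
move=> [sY /andP[V0 VY]].
have adm := mpc_admissible sY; have sY' := state_cl_step sY adm.
have dY0 : 0 <= d Y (Xs j) by exact: dist_stationary_ge0 sY.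
have aV := alpha_dist_le_V_tilde N0 sY.
have arho := class_K_ge0 alpha_Kinf.1 (ltW rho_gt0).
have Yrho : cl_ball sys Xs d rho%:E j Y.
  split=> //; apply: (@le_trans _ _ (class_Kinv alpha (alpha rho))%:E).
    by rewrite -er_map_le_class_Kinv ?(le_trans aV)//; exact: alpha_Kinf.
  by rewrite lee_fin class_Kinv_ge ?(ltW rho_gt0)//; exact: alpha_Kinf.
have [x xE /andP[x0 xrho]] := cl_ballP Yrho.
have [v vE /andP[v0 _]] := ereal_between V0 VY.
split=> //; exists x, v.
have := V_tilde_decrease N1 (sub_cl_ball rho_r Yrho) (le_trans thN_rho rho_r)
  (le_trans thN_rho rho_eps) (le_trans thN_rho rho_epst).
have le_t : er_map alpha (d Y (Xs j)) <= tl j Y (mu N j Y).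
  by have [_ _ le_tl] := diss; exact: le_tl.
have := V_tilde_le_dist N0 (le_trans rho_epst epst_le) Yrho.
have t0 := ell_tilde_ge0 sY adm; have V'0 := V_tilde_ge0 N sY'.
move: aV le_t; rewrite xE vE -EFinD /= lee_fin => av le_t.
rewrite lee_fin => vg dec.
have [t tE /andP[_ _]] := ereal_between t0 (le_trans (leeDl _ V'0) dec).
have [v' v'E /andP[v'0 _]] := ereal_between V'0 (le_trans (leeDr _ t0) dec).
exists v', t; split=> //; move: dec le_t; rewrite tE v'E -EFinD !lee_fin.
by move=> dec le_t; split=> //; rewrite av.
Qed.

(** If [v] exceeds [gtV (alpha^-1 (2 * nu N))], then so does its upper bound
    [gtV x], that is [2 * nu N < alpha x], and the decrease outweighs the error.
    Otherwise [v], which grows by at most [nu N], stays below [residual N]. *)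
Lemma decrease_or_residual (x v v' t : R) :
  (0 <= x)%R -> (alpha x <= v <= gtV x)%R -> (alpha x <= t)%R ->
  (t + v' <= v + nuN N)%R ->
  (v' <= v - alpha x / 2%:R)%R \/ (v' <= residual N)%R.
Proof.
move=> x0 /andP[av vg] le_t dec.
have nu2 : (0 <= 2%:R * nuN N)%R by rewrite mulr_ge0// nu_ge0.
have a0 := class_K_ge0 alpha_Kinf.1 x0.
have [small|large] := leP v (gtV (class_Kinv alpha (2%:R * nuN N))).
  right; rewrite /residual; lra.
left; have := lt_le_trans large vg.
rewrite (class_K_lt gtV_Kinf.1) ?(class_Kinv_ge0 alpha_Kinf)//.
rewrite ltNge (class_Kinv_le alpha_Kinf)// -ltNge; lra.
Qed.

Lemma sublevel_invariant a : (residual N <= a)%R -> (a <= alpha rho)%R ->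
  forward_invariant sys (mu N) (V_tilde_preim sys Xs Us lambda N a).
Proof.
move=> ra arho j Y [sY /andP[V0 Va]].
have YY : Yset N j Y.
  by split=> //; rewrite V0 (le_trans Va)// lee_fin.
have [sY' _ [x [v [v' [t [[dE vE v'E tE] [x0 av v'0 le_t dec]]]]]]] :=
  closed_loop_step YY.
split=> //; rewrite v'E !lee_fin v'0 /=.
move: Va; rewrite vE lee_fin => va.
have a0 := class_K_ge0 alpha_Kinf.1 x0.
by have [|] := decrease_or_residual x0 av le_t dec => ?; lra.
Qed.

Hypothesis residual_small : (residual N <= alpha rho)%R.

Lemma Yset_cl_traj j0 j Y : Yset N j0 Y ->
  Yset N (j0 + j)%N (cl_traj sys (mu N) j0 Y j).
Proof.
move=> YY; elim: j => [|j IH]; first by rewrite addn0.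
by rewrite addnS; apply: sublevel_invariant => //; exact: IH.
Qed.

Section above_residual.
Variable a : R.
Hypotheses (ra : (residual N <= a)%R) (arho : (a <= alpha rho)%R).
Local Notation Pset := (V_tilde_preim sys Xs Us lambda N a).

(** If the next modified value is at most [residual N], the next state has left
    the domain of the Lyapunov function. *)
Lemma V_tilde_lyapunov :
  uniform_lyapunov sys Xs d (mu N) (fun j => Yset N j `\` Pset j) (Vt N).
Proof.
split=> [j Y [[_ /andP[V0 VY]] _]|].
  by rewrite V0 (le_lt_trans VY)// ltry.
exists alpha, gtV, (2%:R^-1 \*o alpha).
split=> //; [exact: alpha_Kinf|exact: class_KZ alpha_Kinf.1|].
move=> j Y [YY nPY] [YY' nPY'].
have [sY' _ [x [v [v' [t [[dE vE v'E tE] [x0 av v'0 le_t dec]]]]]]] :=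
  closed_loop_step YY.
rewrite dE vE v'E -EFinB !lee_fin /= mulrC; split=> //.
have [//|v'r] := decrease_or_residual x0 av le_t dec.
exfalso; apply: nPY'; split=> //; rewrite v'E !lee_fin v'0.
exact: le_trans ra.
Qed.

(** By forward invariance, a trajectory that is outside of the sublevel set was
    outside of it at all earlier times, so the modified value has decreased in
    every step. *)
Lemma dist_cl_traj_le j0 j Y : Yset N j0 Y ->
  ~ Pset (j0 + j)%N (cl_traj sys (mu N) j0 Y j) ->
  d (cl_traj sys (mu N) j0 Y j) (Xs (j0 + j)%N) <=
    er_map (decay_bound alpha gtV ^~ j%:R) (d Y (Xs j0)).
Proof.
move=> YY nP.
pose Z i := cl_traj sys (mu N) j0 Y i.
have nPi i : (i <= j)%N -> ~ Pset (j0 + i)%N (Z i).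
  move=> ij Pi; apply: nP; rewrite -(subnKC ij).
  elim: (j - i)%N => [|k IH]; first by rewrite addn0.
  by rewrite !addnS; exact: (sublevel_invariant ra arho IH).
pose x i := fine (d (Z i) (Xs (j0 + i)%N)).
pose v i := fine (Vt N (j0 + i)%N (Z i)).
have stepZ i : [/\ d (Z i) (Xs (j0 + i)%N) = (x i)%:E, (0 <= x i)%R,
    (alpha (x i) <= v i <= gtV (x i))%R &
    (i < j)%N -> (v i.+1 <= v i - alpha (x i) / 2%:R)%R].
  have [sY' _ [xi [vi [v' [t [[dE vE v'E tE] [x0 av v'0 le_t dec]]]]]]] :=
    closed_loop_step (Yset_cl_traj i YY).
  have -> : x i = xi by rewrite /x dE.
  have -> : v i = vi by rewrite /v vE.
  split=> // ij; have -> : v i.+1 = v' by rewrite /v addnS v'E.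
  have [//|v'r] := decrease_or_residual x0 av le_t dec.
  exfalso; apply: (nPi i.+1 ij); split; first by rewrite addnS.
  by rewrite addnS v'E !lee_fin v'0 (le_trans v'r).
have [dj _ _ _] := stepZ j; have [d0 _ _ _] := stepZ 0%N.
rewrite -/(Z j) dj; move: d0; rewrite /Z addn0 /= => ->; rewrite lee_fin.
apply: (@decay_boundP _ _ _ v); [exact: alpha_Kinf|by []| |] => i ij.
  by have [_ ? /andP[? ?] _] := stepZ i.
by have [_ _ _] := stepZ i; exact.
Qed.

End above_residual.

(** The closed-loop inputs as an open-loop control sequence, so that the results
    on costs along trajectories apply to the closed loop. *)
Definition cl_control Y : nat -> Omega -> U :=
  fun i => mu N i (cl_traj sys (mu N) 0 Y i).

Lemma traj_cl_control Y i :
  traj sys 0 Y (cl_control Y) i = cl_traj sys (mu N) 0 Y i.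
Proof. by elim: i => //= i ->; rewrite add0n. Qed.

Lemma cl_control_admissible K Y : Yset N 0 Y ->
  Uad_fin sys K 0 Y (cl_control Y).
Proof.
move=> YY k _; rewrite traj_cl_control; apply: mpc_admissible.
by have [] := Yset_cl_traj k YY.
Qed.

Lemma Jcl_cost K Y : Jcl sys (mu N) K Y = J sys K 0 Y (cl_control Y).
Proof. by apply: eq_bigr => k _; rewrite traj_cl_control. Qed.

Lemma cost_tilde_closed_loop_le K Y : Yset N 0 Y ->
  cost sys tl K 0 Y (cl_control Y) + Vt N K (cl_traj sys (mu N) 0 Y K) <=
  Vt N 0 Y + (K%:R * nuN N)%:E.
Proof.
move=> YY; elim: K => [|K IH].
  by rewrite /cost big_geq// mul0r add0e adde0.
have [_ _ [x [v [v' [t [[_ vE v'E tE] [_ _ _ _ dec]]]]]]] :=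
  closed_loop_step (Yset_cl_traj K YY).
rewrite -addn1 costD cost1 traj_cl_control !add0n addn1 addn0 -addeA.
move: vE v'E tE IH; rewrite add0n => vE v'E tE IH.
rewrite [X in X + Vt _ _ _]tE [cl_traj _ _ _ _ _]/= add0n v'E -EFinD.
apply: (@le_trans _ _ (cost sys tl K 0 Y (cl_control Y) + (v + nuN N)%:E)).
  by rewrite leeD2l// lee_fin.
rewrite EFinD addeA -(natr1 K) mulrDl mul1r.
rewrite [X in _ <= _ + X]EFinD addeA leeD2r//.
by rewrite -vE.
Qed.

(** Both trajectories have the same initial storage, and their final storages
    differ by at most [2 * glam k]; so it suffices to compare the modified
    costs. That of the closed loop is at most the modified value, up to the
    accumulated errors. Any trajectory ending near stationarity can be
    continued at a modified cost of at most [gtV k], so that its own modified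
    cost is at least the modified value minus [gtV k]. *)
Lemma closed_loop_cost_le K Y Vs (k : R) : Yset N 0 Y ->
  Uad_fin sys K 0 Y Vs -> (k <= epst)%R ->
  cl_ball sys Xs d k%:E K (traj sys 0 Y Vs K) ->
  d (cl_traj sys (mu N) 0 Y K) (Xs K) <= k%:E ->
  Jcl sys (mu N) K Y <=
    J sys K 0 Y Vs + (gtV k + 2%:R * glam k)%:E + (K%:R * nuN N)%:E.
Proof.
move=> YY adV ke Vs_near cl_near; have [sY /andP[V0 VY]] := YY.
have [sK _] : Yset N K (cl_traj sys (mu N) 0 Y K).
  by have := Yset_cl_traj K YY; rewrite add0n.
have adC := cl_control_admissible (K := K) YY.
have [v vE _] := ereal_between V0 VY.
have cl_le : cost sys tl K 0 Y (cl_control Y) <= (v + K%:R * nuN N)%:E.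
  rewrite EFinD -vE; apply: le_trans (cost_tilde_closed_loop_le K YY).
  by rewrite leeDl// V_tilde_ge0.
have [cl clE /andP[_ cl_v]] := ereal_between (cost_tilde_ge0 sY adC) cl_le.
have l1 :
    (`|lambda K (cl_traj sys (mu N) 0 Y K) - lambda K (Xs K)| <= glam k)%R.
  exact: lambda_near_stationary.
have l2 := lambda_near_stationary ke Vs_near.
have k0 : (0 <= k)%R.
  by have [x _ /andP[x0 xk]] := cl_ballP Vs_near; exact: le_trans xk.
have cost_ge : v%:E <= cost sys tl K 0 Y Vs + (gtV k)%:E.
  rewrite -vE; have c0 := cost_tilde_ge0 sY adV.
  have [NK|KN] := leqP N K.
    apply: le_trans (V_tilde_le sY NK) _.
    apply: (@le_trans _ _ (cost sys tl K 0 Y Vs)).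
      by apply: ereal_inf_lbound; exists Vs.
    by rewrite leeDl// lee_fin (class_K_ge0 gtV_Kinf.1).
  have [fin|] := boolP (cost sys tl K 0 Y Vs \is a fin_num); last first.
    by rewrite ge0_fin_numE// -leNgt leye_eq => /eqP ->; rewrite leey.
  rewrite -(subnKC (ltnW KN)).
  apply: le_trans (value_le_cost_value (N - K) adV fin) _.
  rewrite leeD2l// add0n; apply: V_tilde_near_stationary Vs_near.
    by rewrite subn_gt0.
  exact: le_trans epst_le.
move: clE cost_ge; rewrite Jcl_cost !cost_tildeE traj_cl_control add0n.
case: (J sys K 0 Y (cl_control Y)) => // jc [jcE].
case: (J sys K 0 Y Vs) => [jv| |]//; last by move=> *; exact: leey.
rewrite -!EFinD !lee_fin => cost_ge.
move: l1 l2; rewrite !ler_norml => /andP[? ?] /andP[? ?].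
have {}jcE : (jc = cl - (lambda 0%N Y -
    lambda K (cl_traj sys (mu N) 0 Y K) - K%:R * ls))%R by rewrite -jcE; ring.
lra.
Qed.

Section terminal_error.
Variable a : R.
Hypotheses (ra : (residual N <= a)%R) (arho : (a <= alpha rho)%R).
Local Notation kappa K Y :=
  (maxe (er_map (decay_bound alpha gtV ^~ K%:R) (d Y (Xs 0%N)))
     (class_Kinv alpha a)%:E).

Lemma dist_cl_traj_terminal_le K Y : Yset N 0 Y ->
  d (cl_traj sys (mu N) 0 Y K) (Xs K) <= kappa K Y.
Proof.
move=> YY; rewrite le_max; apply/orP.
have [[sK /andP[_ VK]]|nP] := pselect
    (V_tilde_preim sys Xs Us lambda N a K (cl_traj sys (mu N) 0 Y K)).
  right; rewrite -er_map_le_class_Kinv; last 2 first.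
  - exact: dist_stationary_ge0 sK.
  - by apply: le_trans ra; rewrite addr_ge0 ?nu_ge0//
      (class_K_ge0 gtV_Kinf.1)// (class_Kinv_ge0 alpha_Kinf)// mulr_ge0// nu_ge0.
  - by apply: le_trans VK; exact: alpha_dist_le_V_tilde.
  - exact: alpha_Kinf.
by left; apply: (@dist_cl_traj_le a) => //; rewrite add0n.
Qed.

Lemma closed_loop_performance K Y : Yset N 0 Y -> kappa K Y <= epst%:E ->
  Jcl sys (mu N) K Y <=
    ereal_inf [set J sys K 0 Y Vs | Vs in Uad_term sys Xs d K (kappa K Y) Y] +
    (gtV (fine (kappa K Y)) + 2%:R * glam (fine (kappa K Y)))%:E +
    (K%:R * nuN N)%:E.
Proof.
move=> YY ke; have cl_near := dist_cl_traj_terminal_le K YY.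
have [sK _] : Yset N K (cl_traj sys (mu N) 0 Y K).
  by have := Yset_cl_traj K YY; rewrite add0n.
have [k kE /andP[k0 kepst]] : exists2 k, kappa K Y = k%:E & (0 <= k <= epst)%R.
  apply: ereal_between => //; apply: le_trans cl_near.
  exact: dist_stationary_ge0 sK.
rewrite kE in cl_near *.
rewrite -addeA addeC -EFinD.
apply: lee_addl_ereal_inf => _ [Vs [adV Vs_near] <-].
rewrite addeC EFinD addeA.
by apply: closed_loop_cost_le => //.
Qed.

End terminal_error.

End fixed_horizon.
Hypothesis gV_cvg0 : (gV p.1 p.2 @[p --> filter_prod +oo 0^'+] --> 0)%R.

Lemma vartheta_cvg0 : (thN n @[n --> \oo] --> 0)%R.
Proof.
apply: (class_K_cvg0 (u := fun n => C / (n%:R / 12%:R))%R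
  (class_K_inv alpha_Kinf)) => [n|].
  by rewrite !divr_ge0//; exact/ltW/C_gt0.
rewrite -[X in _ --> X](mulr0 (C * 12%:R)%R).
rewrite (_ : (fun _ => _) = fun n => (C * 12%:R * n%:R^-1)%R); last first.
  by apply/funext => n; rewrite invf_div mulrA.
apply: cvgMr; apply/cvgrPdist_lt => e e0; near=> n.
have n0 : (0 < n)%N by near: n; exact: nbhs_infty_gt.
rewrite sub0r normrN gtr0_norm ?invr_gt0 ?ltr0n// invf_plt ?posrE ?ltr0n//.
by near: n; exact: nbhs_infty_gtr.
Unshelve. all: by end_near. Qed.

Lemma vartheta_gt0 N : (0 < N)%N -> (0 < thN N)%R.
Proof.
move=> N0; have C0 := C_gt0; have [_ _ a0] := alpha_Kinf.1.
have CN : (0 < C / (N%:R / 12%:R))%R by rewrite !divr_gt0// ltr0n.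
by rewrite (class_Kinv_lt alpha_Kinf)// ?a0// ltW.
Qed.

Lemma nu_cvg0 : (nuN n @[n --> \oo] --> 0)%R.
Proof.
have th0 := vartheta_ge0; have thc := vartheta_cvg0.
have gVc : (gV (n%:R / 2%:R) (thN n) @[n --> \oo] --> 0)%R.
  have H : (((n%:R / 2%:R)%R, thN n) @[n --> \oo] -->
      filter_prod (pinfty_nbhs R) (0 : R)^'+).
    move=> S [[A B] /= [[M [_ MA]] nB] AB].
    have thB : \forall n \near \oo, (0 < thN n -> B (thN n))%R := thc _ nB.
    suff : \forall n \near \oo, S ((n%:R / 2%:R)%R, thN n) by [].
    near=> n; apply: AB; split => /=.
      have : (M * 2%:R < n%:R)%R by near: n; exact: nbhs_infty_gtr.
      by rewrite -ltr_pdivlMr//; exact: MA.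
    have : (0 < thN n)%R by apply: vartheta_gt0; near: n; exact: nbhs_infty_gt.
    by near: n.
  exact: cvg_comp H gV_cvg0.
rewrite /nu -[X in _ --> X](addr0 0%R); apply: cvgD => //; last first.
  by rewrite -[X in _ --> X](mulr0 4%:R); exact: cvgMr.
rewrite -[X in _ --> X](addr0 0%R); apply: cvgD => //.
  rewrite -[X in _ --> X](mulr0 8%:R); apply: cvgMr.
  exact: class_K_cvg0 gtV_Kinf.1 _ _.
rewrite -[X in _ --> X](mulr0 4%:R); apply: cvgMr.
exact: class_K_cvg0 glam_Kinf.1 _ _.
Unshelve. all: by end_near. Qed.

Lemma residual_cvg0 : (residual n @[n --> \oo] --> 0)%R.
Proof.
have nu0 := nu_ge0; have nuc := nu_cvg0.
rewrite /residual -[X in _ --> X](addr0 0%R); apply: cvgD => //.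
have K := class_K_comp gtV_Kinf.1 (class_K_inv alpha_Kinf).
apply: (class_K_cvg0 (u := fun n => 2%:R * nuN n)%R K) => [n|].
  by rewrite mulr_ge0.
by rewrite -[X in _ --> X](mulr0 2%:R); exact: cvgMr.
Qed.

(** The level [a] is left open: it will be the value at [N] of a class L
    majorant of [residual]. *)
Lemma mpc_estimates : (residual n @[n --> \oo] --> 0)%R /\
  \forall N \near \oo, forall a, (residual N <= a)%R -> (a <= alpha rho)%R ->
  let Pset := V_tilde_preim sys Xs Us lambda N a in
  [/\ forward_invariant sys (mu N) (Yset N),
    forward_invariant sys (mu N) Pset,
    uniform_lyapunov sys Xs d (mu N) (fun j => Yset N j `\` Pset j) (Vt N),
    forall j0 j Y, Yset N j0 Y ->
      ~ Pset (j0 + j)%N (cl_traj sys (mu N) j0 Y j) ->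
      d (cl_traj sys (mu N) j0 Y j) (Xs (j0 + j)%N) <=
        er_map (decay_bound alpha gtV ^~ j%:R) (d Y (Xs j0)) &
    forall K Y, Yset N 0 Y ->
      let kappa := maxe (er_map (decay_bound alpha gtV ^~ K%:R) (d Y (Xs 0%N)))
        (class_Kinv alpha a)%:E in
      cl_ball sys Xs d rho%:E 0 Y /\ (kappa <= epst%:E ->
      Jcl sys (mu N) K Y <=
        ereal_inf [set J sys K 0 Y Vs | Vs in Uad_term sys Xs d K kappa Y] +
        (gtV (fine kappa) + 2%:R * glam (fine kappa))%:E + (K%:R * nuN N)%:E)].
Proof.
split; first exact: residual_cvg0.
have /cvgrPdist_lt/(_ rho rho_gt0) th_rho := vartheta_cvg0.
near=> N => a ra arho Pset.
have N1 : (1 < N)%N by near: N; exact: nbhs_infty_gt.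
have thN_rho : (thN N <= rho)%R.
  apply/ltW; rewrite -[ltLHS]ger0_norm ?vartheta_ge0// -normrN -sub0r.
  by near: N.
have res_rho := le_trans ra arho.
split; [exact: sublevel_invariant|exact: sublevel_invariant|
  exact: V_tilde_lyapunov|by move=> j0 j Y; exact: dist_cl_traj_le|].
move=> K Y YY; split; last exact: closed_loop_performance.
by have [] := closed_loop_step N1 thN_rho YY.
Unshelve. all: by end_near. Qed.

End dissipative_system.

(** * Stability and performance *)

Theorem theorem6p6 (R : realType) (X U W : completeNormedModType R)
  (dO : measure_display) (Omega : measurableType dO) (P : probability Omega R)
  (sys : stochastic_ocp X U W P)
  (sepX : separable X) (sepU : separable U) (sepW : separable W)
  (mu : nat -> nat -> (Omega -> X) -> (Omega -> U)) (mu_mpc : mpc_feedback sys mu)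
  (d : (Omega -> X) -> (Omega -> X) -> \bar R) (d_pm : pseudometric d)
  (Xs : nat -> Omega -> X) (Us : nat -> Omega -> U)
  (statXU : stationary_pair sys Xs Us)
  (ell_s_fin : ell_s sys Xs Us \is a fin_num)
  (* (1) *)
  (lambda : nat -> (Omega -> X) -> R) (alpha : R -> R)
  (diss : strictly_dissipative sys Xs Us d lambda alpha)
  (* (2) *)
  (r Clam Clow CV : R) (r_gt0 : 0 < r)
  (Clam_gt0 : 0 < Clam) (Clow_gt0 : 0 < Clow) (CV_gt0 : 0 < CV)
  (lambda_bnd : forall j Y, cl_ball sys Xs d r%:E j Y -> `|lambda j Y| <= Clam)
  (lambda_low : forall j Y, state sys j Y -> - Clow <= lambda j Y)
  (cheap : cheaply_reachable sys Xs Us d r CV)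
  (* (3) *)
  (eps : R) (eps_gt0 : 0 < eps) (gV : R -> R -> R)
  (gV_ge0 : forall s rho, 0 <= s -> 0 <= rho -> 0 <= gV s rho)
  (gV_cvg0 : gV p.1 p.2 @[p --> filter_prod +oo 0^'+] --> 0)
  (gV_mono : forall rho, 0 <= rho ->
     (forall s t, 0 <= s -> s <= t -> gV t rho <= gV s rho) \/
     (forall s t, 0 <= s -> s <= t -> gV s rho <= gV t rho))
  (gV_ndecr : forall s rho rho', 0 <= s -> 0 <= rho -> rho <= rho' ->
     gV s rho <= gV s rho')
  (V_cont : forall N j Y, (0 < N)%N -> cl_ball sys Xs d eps%:E j Y ->
     (`|V sys N j Y - V sys N j (Xs j)| <= er_map (gV N%:R) (d Y (Xs j)))%E)
  (* (4) *)
  (ell_tilde0 : forall j, ell_tilde sys Xs Us lambda j (Xs j) (Us j) = 0%E)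
  (* (5) *)
  (epst rt : R) (epst_gt0 : 0 < epst) (epst_le : epst <= rt) (glam gtV : R -> R)
  (glam_Kinf : class_Kinf glam) (gtV_Kinf : class_Kinf gtV)
  (lambda_cont : forall j Y, cl_ball sys Xs d epst%:E j Y ->
     ((`|lambda j Y - lambda j (Xs j)|)%:E <= er_map glam (d Y (Xs j)))%E)
  (V_tilde_cont : forall N j Y, (0 < N)%N -> cl_ball sys Xs d rt%:E j Y ->
     (`|V_tilde sys Xs Us lambda N j Y - V_tilde sys Xs Us lambda N j (Xs j)|
        <= er_map gtV (d Y (Xs j)))%E)
  (* (6) *)
  (epsh : R) (epsh_gt0 : 0 < epsh) (gVinf : R -> R) (gVinf_K : class_K gVinf)
  (V_hat_cont : forall j Y, cl_ball sys Xs d epsh%:E j Y ->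
     (`|V_hat_inf sys Xs Us j Y - V_hat_inf sys Xs Us j (Xs j)|
        <= er_map gVinf (d Y (Xs j)))%E) :
  exists (theta0 : R) (N0 : nat) (delta : R -> R) (beta : R -> R -> R),
    let Yset N := V_tilde_preim sys Xs Us lambda N theta0 in
    let Pset N := V_tilde_preim sys Xs Us lambda N (delta N%:R) in
    [/\ 0 < theta0, (0 < N0)%N, class_L delta & class_KL beta] /\
    (* (a) *)
    (forall N, (N0 <= N)%N ->
      [/\ forward_invariant sys (mu N) (Yset N),
          forward_invariant sys (mu N) (Pset N),
          uniform_lyapunov sys Xs d (mu N) (fun j => Yset N j `\` Pset N j)
            (V_tilde sys Xs Us lambda N) &
          forall j0 j Y, Yset N j0 Y ->
            ~ Pset N (j0 + j)%N (cl_traj sys (mu N) j0 Y j) ->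
            (d (cl_traj sys (mu N) j0 Y j) (Xs (j + j0)%N)
               <= er_map (beta ^~ j%:R) (d Y (Xs j0)))%E]) /\
    (* (b) *)
    (exists delta2 delta3 : R -> R, [/\ class_L delta2, class_L delta3 &
      exists N1 K1 : nat, forall N K Y, (N1 <= N)%N -> (K1 <= K)%N ->
        Yset N 0%N Y ->
        let kappa := maxe (er_map (beta ^~ K%:R) (d Y (Xs 0%N)))
                          (class_Kinv alpha (delta N%:R))%:E in
        (Jcl sys (mu N) K Y <=
          ereal_inf [set J sys K 0 Y Vs | Vs in Uad_term sys Xs d K kappa Y]
          + (delta2 N%:R)%:E
          + (K%:R * nu alpha gtV glam gV (Clam + Clow + CV) N)%:E
          + (delta3 K%:R)%:E)%E]).
Proof.
have Ka : class_Kinf alpha by case: diss.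
(* The sublevel set of [alpha rho] is contained in the ball of radius [rho]. *)
pose rho := Num.min r (Num.min eps epst).
have rho0 : 0 < rho by rewrite !lt_min r_gt0 eps_gt0.
have [rho_r rho_eps rho_epst] : [/\ rho <= r, rho <= eps & rho <= epst].
  by split; rewrite /rho !ge_min lexx ?orbT.
have [res_cvg0 [N0 _ est]] := mpc_estimates sepX sepU sepW d_pm statXU
  ell_s_fin diss ell_tilde0 lambda_bnd lambda_low cheap Clam_gt0 Clow_gt0
  CV_gt0 mu_mpc gV_ge0 gV_mono gV_ndecr V_cont epst_le glam_Kinf gtV_Kinf
  lambda_cont V_tilde_cont rho0 rho_r rho_eps rho_epst gV_cvg0.
have [delta Ldelta res_le] := class_L_majorant res_cvg0.
have arho0 : 0 < alpha rho.
  by have [_ alpha_incr alpha0] := Ka.1; rewrite -alpha0 alpha_incr.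
have [M [_ delta_small]] : \forall t \near +oo, delta t < alpha rho.
  by have [_ _ /cvgr_lt] := Ldelta; apply.
have Kb := class_KL_decay_bound Ka gtV_Kinf.
set b := decay_bound alpha gtV in Kb est *.
have [_ b_K b_L] := Kb.
pose N1 := maxn N0 (Num.truncn M).+1.
have delta_le N : (N1 <= N)%N -> delta N%:R <= alpha rho.
  move=> N1N; apply/ltW/delta_small; apply: lt_le_trans (truncnS_gt M) _.
  by rewrite ler_nat (leq_trans _ N1N)// leq_maxr.
exists (alpha rho), N1.+1, delta, b => Yset Pset.
split; first by split.
split.
  move=> N NN; have N1N := ltnW NN.
  have [fiY fiP lyap dist _] := est N (leq_trans (leq_maxl _ _) N1N) _
    (res_le N) (delta_le N N1N).
  split=> // j0 j Y YY nP; rewrite addnC; exact: dist.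
pose F := gtV \+ 2%:R \*o glam.
have KF : class_K F.
  by apply: class_KD; [exact: gtV_Kinf.1|exact: class_KZ glam_Kinf.1].
have b_rho := b_L _ rho0.
exists (F \o (class_Kinv alpha \o delta)), (F \o b rho); split.
- by apply: class_K_L_comp KF _; apply: class_K_L_comp (class_K_inv Ka) _.
- exact: class_K_L_comp.
have [M' [_ b_small]] : \forall t \near +oo, b rho t < epst.
  by have [_ _ /cvgr_lt] := b_rho; apply.
exists N1, (Num.truncn M').+1 => N K Y NN KK YY.
have dN := delta_le N NN.
have dN0 : 0 < delta N%:R by apply: class_L_gt0 Ldelta _.
have [_ _ _ _ perf] := est N (leq_trans (leq_maxl _ _) NN) _ (res_le N) dN.
have [Y_rho {}perf] := perf K Y YY.
have [sY dYle] := Y_rho.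
have [x xE /andP[x0 xrho]] : exists2 x, d Y (Xs 0%N) = x%:E & 0 <= x <= rho.
  apply: (ereal_between _ dYle); have [d0 _ _ _] := d_pm.
  by have [[rY _] [[rX _] _ _ _]] := (sY, statXU); exact: d0.
have KbK : class_K (b ^~ K%:R) by exact: b_K.
have bx0 : 0 <= b x K%:R by exact: class_K_ge0 KbK x0.
have bxK : b x K%:R <= b rho K%:R by rewrite (class_K_le KbK)// ltW.
have bK : b rho K%:R <= epst.
  apply/ltW/b_small; apply: lt_le_trans (truncnS_gt M') _.
  by rewrite ler_nat.
have dK : class_Kinv alpha (delta N%:R) <= rho.
  by rewrite (class_Kinv_ge Ka)// ltW.
have dK0 : 0 <= class_Kinv alpha (delta N%:R).
  by rewrite (class_Kinv_ge0 Ka) ?ltW.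
move: perf; rewrite /= xE /= -EFin_max => perf.
apply: le_trans (perf _) _.
  by rewrite lee_fin ge_max (le_trans bxK bK) (le_trans dK).
set u := class_Kinv alpha _.
have Frho : F (b x K%:R) <= F (b rho K%:R).
  by rewrite (class_K_le KF)// (le_trans bx0).
have F0 : 0 <= F (b rho K%:R) by apply: le_trans Frho; exact: class_K_ge0 KF _.
have Fu : 0 <= F u by exact: class_K_ge0 KF _.
(* A class K function of the maximum of both radii is at most the sum of its
   values. *)
have Fmax : F (Num.max (b x K%:R) u) <= F u + F (b rho K%:R).
  by case: (leP (b x K%:R) u) => _; lra.
rewrite -!addeA leeD2l// -!EFinD lee_fin [leRHS]addrCA [leRHS]addrC lerD2r.
exact: Fmax.
Qed.
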